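(* Every connected vacuum graph of the MO tensor model with degree $\omega=\frac12$ (i.e. every next-to-leading order graph) is obtained from the double-tadpole $\Gamma_{2tp}$ by replacing each of its two lines by a melonic two-point graph (possibly a bare line).
   Context: The MO tensor model concerns a complex tensor $\phi_{ijk}$, $i,j,k\in\{1,\dots,N\}$, with quadratic action $\sum_{ijk}\overline{\phi}_{ijk}\phi_{ijk}$ and quartic interaction $\lambda\sum \phi_{ijk}\overline{\phi}_{kj'i'}\phi_{k'ji'}\overline{\phi}_{k'j'i}$; the free-energy perturbative expansion is indexed by its connected vacuum Feynman graphs, whose amplitude is $\lambda^V N^{3-\omega}$. These graphs are stranded graphs built as follows. Each vertex has four half-lines $h_1,h_2,h_3,h_4$ in cyclic order, carrying $\phi_{ijk},\overline{\phi}_{kj'i'},\phi_{k'ji'},\overline{\phi}_{k'j'i}$ respectively; $h_1,h_3$ are labelled $+$ and $h_2,h_4$ are labelled $-$. Each half-line carries three strands (one per index slot), and inside a vertex two strands are joined when they carry the same index letter: $i$ joins $h_1,h_4$; $k$ joins $h_1,h_2$; $i'$ joins $h_2,h_3$; $k'$ joins $h_3,h_4$; $j$ joins $h_1,h_3$; $j'$ joins $h_2,h_4$. A line joins a $+$ half-line to a $-$ half-line, connecting the strands in the same index slot. A (connected) vacuum graph is a finite connected set of vertices all of whose half-lines are paired by lines; a two-point graph has exactly two unpaired (external) half-lines, one $+$ and one $-$. A face is a closed cycle formed by strands. The degree of a vacuum graph with $V$ vertices and $F$ faces is $\omega=3+\frac32V-F$ (equal to the sum of the genera of its three jackets, each in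 $\frac12\mathbb{N}$). A melonic two-point graph is a two-point graph which is either a bare line or whose closure (joining its two external half-lines into a line) is a vacuum graph of degree $0$. The double-tadpole $\Gamma_{2tp}$ is the vacuum graph with a single vertex, whose two lines join $h_1$ to $h_2$ and $h_3$ to $h_4$ (equivalently, up to isomorphism, $h_1$ to $h_4$ and $h_3$ to $h_2$).
   Formalization: The field at h1 is read as φ_{kji} instead of φ_{ijk} (outer slots swapped, the standard MO vertex); with the literal slots the double-tadpole has degree 3/2 and a cyclic 3-vertex graph of degree 1/2 is not obtained from it. *)

(* Defs.v *)
From HB Require Import structures.
From mathcomp Require Import all_boot all_order all_algebra.
Unset Printing Implicit Defensive.
Import GRing.Theory Num.Theory.

(* Half-lines of a vertex: h1,h2,h3,h4 are encoded as 0,1,2,3 : 'I_4.        *)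
(* h1,h3 (even codes) carry phi and are labelled +; h2,h4 carry phibar (-).  *)
(* Index slots of a half-line: 0,1,2 : 'I_3 (first, middle, last index).    *)
Definition plusb (h : 'I_4) : bool := ~~ odd h.

(* The strand structure inside a vertex: vstrand (h,s) = the other end of    *)
(* the internal strand leaving half-line h at slot s.  Convention (see       *)
(* h3 = phi_{k'ji'}, h4 = phibar_{k'j'i}, i.e.                               *)
(*   k : (h1,0)-(h2,0)   i : (h1,2)-(h4,2)   j  : (h1,1)-(h3,1)              *)
(*   i': (h2,2)-(h3,2)   k': (h3,0)-(h4,0)   j' : (h2,1)-(h4,1)              *)
Definition vstrand_nat (h s : nat) : nat * nat :=
  match h, s with
  | 0, 0 => (1, 0) | 0, 1 => (2, 1) | 0, _ => (3, 2)
  | 1, 0 => (0, 0) | 1, 1 => (3, 1) | 1, _ => (2, 2)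
  | 2, 0 => (3, 0) | 2, 1 => (0, 1) | 2, _ => (1, 2)
  | _, 0 => (2, 0) | _, 1 => (1, 1) | _, _ => (0, 2)
  end.

Definition vstrand (x : 'I_4 * 'I_3) : 'I_4 * 'I_3 :=
  let p := vstrand_nat x.1 x.2 in (inord p.1, inord p.2).

(* A stranded graph: a finite set of vertices, and for every half-line      *)
(* (v,h) either the half-line it is joined to by a line, or None (external). *)
Record sgraph := SGraph {
  vtx : finType;
  lnk : vtx * 'I_4 -> option (vtx * 'I_4)
}.
Arguments lnk : clear implicits.

Definition lines_ok (G : sgraph) : Prop :=
  forall x y, lnk G x = Some y -> lnk G y = Some x /\ plusb x.2 != plusb y.2.

Definition adjv (G : sgraph) : rel (vtx G) :=
  fun v w => [exists h : 'I_4, exists k : 'I_4, lnk G (v, h) == Some (w, k)].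

Definition connected (G : sgraph) : Prop :=
  0 < #|{: vtx G}| /\ forall v w : vtx G, connect (adjv G) v w.

Definition vacuum (G : sgraph) : Prop :=
  [/\ lines_ok G, (forall x, lnk G x <> None) & connected G].

(* Faces: connected components of the graph on strand ends (v,h,s) whose    *)
(* edges are the internal strands of vertices and the strands of lines      *)
(* (a line joins the strands in the same slot).                             *)
Definition face_rel (G : sgraph) : rel (vtx G * 'I_4 * 'I_3) :=
  fun x y =>
    ((x.1.1 == y.1.1) && (vstrand (x.1.2, x.2) == (y.1.2, y.2)))
    || ((lnk G x.1 == Some y.1) && (x.2 == y.2)).

Definition nfaces (G : sgraph) : nat := n_comp (face_rel G) predT.

Definition degree (G : sgraph) : rat :=
  (3 + 3 / 2 * (#|{: vtx G}|%:R) - (nfaces G)%:R)%R.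

(* Two-point graphs with at least one vertex, with their external + and -   *)
(* half-lines xp, xm.                                                        *)
Record tpg := TPG {
  tg : sgraph;
  xp : vtx tg * 'I_4;
  xm : vtx tg * 'I_4
}.
Arguments xp : clear implicits.
Arguments xm : clear implicits.

Definition two_point (M : tpg) : Prop :=
  [/\ lines_ok (tg M), plusb (xp M).2 /\ ~~ plusb (xm M).2,
      lnk (tg M) (xp M) = None, lnk (tg M) (xm M) = None &
      forall x, lnk (tg M) x = None -> x = xp M \/ x = xm M].

Definition tp_closure (M : tpg) : sgraph :=
  @SGraph (vtx (tg M))
    (fun x => if x == xp M then Some (xm M)
              else if x == xm M then Some (xp M)
              else lnk (tg M) x).

(* A melonic two-point graph: None = bare line; Some M = a two-point graph  *)
(* whose tp_closure is a (connected) vacuum graph of degree 0.                  *)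
Definition melonic2 (o : option tpg) : Prop :=
  match o with
  | None => True
  | Some M => [/\ two_point M, vacuum (tp_closure M) & degree (tp_closure M) = 0%R]
  end.

(* Insertion into the double tadpole.  The double tadpole has one vertex v0 *)
(* with lines h1-h2 and h3-h4.  The line h1-h2 is replaced by o1, the line  *)
(* h3-h4 by o2: h1 (+) is joined to the external - half-line of o1, and the *)
(* external + half-line of o1 is joined to h2 (-); similarly for o2.        *)
Definition hl1 : 'I_4 := @Ordinal 4 0 isT.
Definition hl2 : 'I_4 := @Ordinal 4 1 isT.
Definition hl3 : 'I_4 := @Ordinal 4 2 isT.
Definition hl4 : 'I_4 := @Ordinal 4 3 isT.

Definition vo (o : option tpg) : finType :=
  match o with Some M => vtx (tg M) | None => void end.

(* where the external - (resp. +) end of the inserted piece is; a bare line *)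
(* leads directly to the v0 half-line b (resp. a).                          *)
Definition endm (o : option tpg) (b : 'I_4) : (vo o * 'I_4) + 'I_4 :=
  match o as o0 return (vo o0 * 'I_4) + 'I_4 with
  | Some M => inl (xm M)
  | None => inr b
  end.

Definition endp (o : option tpg) (a : 'I_4) : (vo o * 'I_4) + 'I_4 :=
  match o as o0 return (vo o0 * 'I_4) + 'I_4 with
  | Some M => inl (xp M)
  | None => inr a
  end.

Definition glue (o : option tpg) (a b : 'I_4) :
    vo o * 'I_4 -> (vo o * 'I_4) + 'I_4 :=
  match o as o0 return vo o0 * 'I_4 -> (vo o0 * 'I_4) + 'I_4 with
  | Some M => fun x =>
      match lnk (tg M) x with
      | Some y => inl y
      | None => inr (if x == xp M then b else a)
      end
  | None => fun _ => inr a
  end.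

Definition ins_vtx (o1 o2 : option tpg) : finType := option (vo o1 + vo o2).

Definition lift1 (o1 o2 : option tpg) (z : (vo o1 * 'I_4) + 'I_4) :
    option (ins_vtx o1 o2 * 'I_4) :=
  match z with
  | inl (v, h) => Some (Some (inl v), h)
  | inr h => Some (None, h)
  end.

Definition lift2 (o1 o2 : option tpg) (z : (vo o2 * 'I_4) + 'I_4) :
    option (ins_vtx o1 o2 * 'I_4) :=
  match z with
  | inl (v, h) => Some (Some (inr v), h)
  | inr h => Some (None, h)
  end.

Definition ins_lnk (o1 o2 : option tpg) (x : ins_vtx o1 o2 * 'I_4) :
    option (ins_vtx o1 o2 * 'I_4) :=
  match x with
  | (None, h) =>
      if h == hl1 then lift1 o1 o2 (endm o1 hl2)
      else if h == hl2 then lift1 o1 o2 (endp o1 hl1)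
      else if h == hl3 then lift2 o1 o2 (endm o2 hl4)
      else lift2 o1 o2 (endp o2 hl3)
  | (Some (inl v), h) => lift1 o1 o2 (glue o1 hl1 hl2 (v, h))
  | (Some (inr v), h) => lift2 o1 o2 (glue o2 hl3 hl4 (v, h))
  end.

Definition insert_2tp (o1 o2 : option tpg) : sgraph :=
  @SGraph (ins_vtx o1 o2) (@ins_lnk o1 o2).

Definition double_tadpole : sgraph := insert_2tp None None.

Definition vsym (pi : 'I_4 -> 'I_4) (tau : 'I_3 -> 'I_3) : Prop :=
  [/\ bijective pi, bijective tau, (forall h, plusb (pi h) = plusb h) &
      forall h s, vstrand (pi h, tau s) =
                  (pi (vstrand (h, s)).1, tau (vstrand (h, s)).2)].

Definition iso (G H : sgraph) : Prop :=
  exists (f : vtx G -> vtx H) (pi : vtx G -> 'I_4 -> 'I_4) (tau : 'I_3 -> 'I_3),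
    [/\ bijective f, (forall v, vsym (pi v) tau) &
        forall v h, lnk H (f v, pi v h) =
                    omap (fun y => (f y.1, pi y.1 y.2)) (lnk G (v, h))].

(* Main.v *)
(* Write F_r for the number of faces of index slot r and E for the involution
   exchanging the two ends of each line.  For two slots r <> s, F_2-valued
   functions on half-lines give Euler's bound F_r + F_s <= V + 2: sums of a
   function on r-faces and a function on s-faces lie in the cycle space of the
   4-regular graph.  In case of equality (a planar jacket) they exhaust it.

   Degree 1/2 means that V is odd and two jackets, {r,s} and {r,t}, are planar.
   The s-faces are straight curves of the planar jacket {r,t}; distinct ones
   cross evenly, so, V being odd, some vertex v is a self-crossing of an s-face.
   Since {r,s} is planar too, a cycle through v using exactly one of the two
   half-lines {h, mv r h} cannot be a sum of faces, so v separates {h, mv r h}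
   from the other two half-lines.  The signs exclude that r is the middle slot,
   and exchanging the outer slots reduces to r = 0.  Then v is the vertex of the
   double tadpole; comparing the faces of the graph with those of the closures
   of the two pieces, Euler's bound forces both pieces to have degree 0. *)
Require Import Defs.
From mathcomp Require Import all_boot all_order all_algebra zify lra.
Import GRing.Theory Num.Theory.

Set Implicit Arguments.
Unset Strict Implicit.
Unset Printing Implicit Defensive.

Local Notation "\xor_ ( i : t ) F" := (\big[addb/false]_(i : t) F%B)
  (at level 36, F at level 36, i at level 50).

(** * Functions to bool invariant under a relation *)

(** Stands in for the rank formula: spaces over F_2 are compared through their cardinals, and the
    fibers of a linear map are the cosets of its kernel. *)
Lemma card_fibers (T R : finType) (f : T -> R) (A : {set T}) n :
  (forall x, x \in A -> #|[set y in A | f y == f x]| = n) ->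
  #|A| = #|f @: A| * n.
Proof.
move=> fib; rewrite -sum1_card (partition_big_imset f) /= -sum_nat_const.
apply: eq_bigr => _ /imsetP[x xA ->]; rewrite -(fib x xA) -sum1_card.
by apply: eq_bigl => y; rewrite !inE.
Qed.

Lemma xor_sum_odd (T : finType) (b : pred T) : \xor_(x : T) b x = odd #|b|.
Proof.
rewrite -sum1_card (big_morph odd oddD (erefl : odd 0 = false)) [RHS]big_mkcond /=.
by apply: eq_bigr => x _; rewrite unfold_in; case: (b x).
Qed.

Definition invf (T : finType) (e : rel T) : {set {ffun T -> bool}} :=
  [set phi : {ffun T -> bool} |
    [forall x, forall y, e x y ==> (phi x == phi y)]].

Lemma invfP (T : finType) (e : rel T) (phi : {ffun T -> bool}) :
  reflect (forall x y, e x y -> phi x = phi y) (phi \in invf e).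
Proof.
rewrite inE; apply: (iffP forallP) => [H x y exy | H x].
  by move: (H x) => /forallP/(_ y)/implyP/(_ exy)/eqP.
by apply/forallP => y; apply/implyP => exy; apply/eqP/H.
Qed.

Lemma invf_connect (T : finType) (e : rel T) (phi : {ffun T -> bool}) x y :
  phi \in invf e -> connect e x y -> phi x = phi y.
Proof.
move=> /invfP inv /connectP[p e_p ->] {y}.
by elim: p x e_p => //= y p IHp x /andP[/inv -> /IHp].
Qed.

(** An invariant function is free on the roots of the components and determined by its values there,
    so counting invariant functions counts components. *)
Lemma card_invf (T : finType) (e : rel T) :
  connect_sym e -> #|invf e| = 2 ^ n_comp e T.
Proof.
move=> sym_e.
have -> : n_comp e T = #|roots e| by apply: eq_card => x; rewrite !inE andbT.
pose D := [pred x | x \in roots e].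
have -> : 2 ^ #|roots e| = #|pffun_on false D predT|.
  by rewrite card_pffun_on card_bool.
pose f (phi : {ffun T -> bool}) := [ffun x => (x \in roots e) && phi x].
rewrite -(card_in_imset (f := f)) => [|phi psi inv1 inv2 /ffunP eq_f].
  apply: eq_card => phi; apply/imsetP/pffun_onP => [[psi _ ->] | [sup _]].
    split=> [|x _ //]; apply/supportP => x; rewrite inE => nx.
    by rewrite ffunE (negPf nx).
  exists [ffun x => phi (fingraph.root e x)].
    apply/invfP => x y exy; rewrite !ffunE; congr (phi _).
    by apply/(fingraph.rootP sym_e)/connect1.
  apply/ffunP => x; rewrite !ffunE.
  case: (boolP (x \in roots e)) => [/eqP -> // | nx] /=.
  by move/supportP: sup => /(_ x nx).
apply/ffunP => x; rewrite (invf_connect inv1 (connect_root e x)).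
rewrite (invf_connect inv2 (connect_root e x)).
have rx : fingraph.root e x \in roots e by exact: roots_root.
by have:= eq_f (fingraph.root e x); rewrite !ffunE rx.
Qed.

(** * Half-lines of a vertex *)

(** Internal strands keep their slot ([vstrandE]), so only the half-line is recorded. The three
    [mv r] and the identity form a Klein four-group acting simply transitively on the half-lines. *)
Definition mv (r : 'I_3) (h : 'I_4) : 'I_4 := (vstrand (h, r)).1.

Lemma val_mv r h : val (mv r h) = (vstrand_nat h r).1.
Proof.
by case: r h => [[|[|[|r]]] Hr] // [[|[|[|[|h]]]] Hh] //; rewrite /= inordK.
Qed.

Lemma vstrandE h r : vstrand (h, r) = (mv r h, r).
Proof.
congr pair; apply: val_inj.
by case: r h => [[|[|[|r]]] Hr] // [[|[|[|[|h]]]] Hh] //; rewrite /= inordK.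
Qed.

Lemma mvK r : involutive (mv r).
Proof.
move=> h; apply: val_inj; rewrite !val_mv.
by case: r h => [[|[|[|r]]] Hr] // [[|[|[|[|h]]]] Hh].
Qed.

Lemma mv_neq r h : mv r h != h.
Proof.
rewrite -val_eqE /= val_mv.
by case: r h => [[|[|[|r]]] Hr] // [[|[|[|[|h]]]] Hh].
Qed.

Lemma mv_mv r s t h : uniq [:: r; s; t] -> mv r (mv s h) = mv t h.
Proof.
move=> u; apply: val_inj; rewrite !val_mv; move: u; rewrite /= !inE -!val_eqE.
case: r => [[|[|[|r]]] Hr] //; case: s => [[|[|[|s]]] Hs] //;
case: t => [[|[|[|t]]] Ht] //; by case: h => [[|[|[|[|h]]]] Hh].
Qed.

Lemma mv_inj r s h : mv r h = mv s h -> r = s.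
Proof.
move/(congr1 val); rewrite !val_mv => e; apply: val_inj; move: e.
case: r => [[|[|[|r]]] Hr] //; case: s => [[|[|[|s]]] Hs] //;
  by case: h => [[|[|[|[|h]]]] Hh].
Qed.

Lemma plusb_mv r h : plusb (mv r h) = (r == 1 :> nat) (+) ~~ plusb h.
Proof.
rewrite /plusb val_mv.
by case: r h => [[|[|[|r]]] Hr] // [[|[|[|[|h]]]] Hh].
Qed.

Lemma uniq_mv r s t h : uniq [:: r; s; t] ->
  uniq [:: h; mv r h; mv s h; mv t h].
Proof.
rewrite /= !inE !negb_or -!andbA => /and4P[rs rt st _].
rewrite !(eq_sym h) !mv_neq /=.
have ne a b : a != b -> mv a h != mv b h.
  by apply: contraNneq => /mv_inj ->.
by rewrite !ne.
Qed.

Lemma mem_mv r s t h k : uniq [:: r; s; t] ->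
  k \in [:: h; mv r h; mv s h; mv t h].
Proof.
move=> u; have sub : {subset [:: h; mv r h; mv s h; mv t h] <= enum 'I_4}.
  by move=> x _; rewrite mem_enum.
have [] := uniq_min_size (uniq_mv h u) sub; first by rewrite size_enum_ord.
by move=> _ ->; rewrite mem_enum.
Qed.

Lemma mv_ind r s t h (P : 'I_4 -> Prop) : uniq [:: r; s; t] ->
  P h -> P (mv r h) -> P (mv s h) -> P (mv t h) -> forall k, P k.
Proof.
move=> u P0 P1 P2 P3 k.
by move: (mem_mv h k u); rewrite !inE => /or4P[] /eqP ->.
Qed.

Lemma xor4 r s t h (q : 'I_4 -> bool) : uniq [:: r; s; t] ->
  \xor_(k : 'I_4) q k = q h (+) q (mv r h) (+) q (mv s h) (+) q (mv t h).
Proof.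
move=> u; rewrite (perm_big [:: h; mv r h; mv s h; mv t h]).
  by rewrite !big_cons big_nil /= addbF !addbA.
apply: uniq_perm (index_enum_uniq _) (uniq_mv h u) _ => k.
by rewrite mem_index_enum mem_mv.
Qed.

Lemma third_slot (r s : 'I_3) : r != s -> exists t, uniq [:: r; s; t].
Proof.
pose o i (lt_i3 : i < 3) : 'I_3 := Ordinal lt_i3.
rewrite -val_eqE.
case: r => [[|[|[|r]]] Hr] //; case: s => [[|[|[|s]]] Hs] // _;
  by [exists (o 2 isT) | exists (o 1 isT) | exists (o 0 isT)].
Qed.

Lemma uniq_slots_sym (r s t : 'I_3) : uniq [:: r; s; t] ->
  [/\ uniq [:: s; r; t], uniq [:: r; t; s] & uniq [:: t; s; r]].
Proof.
rewrite /= !inE !negb_or !andbT (eq_sym s r) (eq_sym t s) (eq_sym t r).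
by case/andP=> /andP[-> ->] ->.
Qed.

Lemma mem_mv_pairs r h k l : k != h -> k != mv r h ->
  l \in [:: h; mv r h; k; mv r k].
Proof.
move=> kh kr.
have u : uniq [:: h; mv r h; k; mv r k].
  have n m : m != mv r m by rewrite eq_sym mv_neq.
  have hk : h != mv r k by apply: contraNneq kr => ->; rewrite mvK.
  rewrite /= !inE !negb_or (inj_eq (inv_inj (mvK r))) hk !n.
  by rewrite (eq_sym h) (eq_sym (mv r h)) kh kr.
have sub : {subset [:: h; mv r h; k; mv r k] <= enum 'I_4}.
  by move=> x _; rewrite mem_enum.
have [] := uniq_min_size u sub; first by rewrite size_enum_ord.
by move=> _ ->; rewrite mem_enum.
Qed.

(** * Euler's bound and planar jackets *)

Section LineInvolution.

Variables (V : finType) (E : V * 'I_4 -> V * 'I_4).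
Hypothesis EK : involutive E.
Hypothesis E_sign : forall x, plusb (E x).2 = ~~ plusb x.2.

Local Notation X := (V * 'I_4)%type.

Definition alpha (r : 'I_3) (x : X) : X := (x.1, mv r x.2).

Definition srel (A : X -> X) : rel X := [rel x y | (E x == y) || (A x == y)].

(** Adjacency after deletion of [B]; [B] is empty for connectedness and a single vertex for
    separation. *)
Definition avoid (B : {set V}) : rel V :=
  [rel a b | [&& a \notin B, b \notin B & [exists h, (E (a, h)).1 == b]]].

Lemma alphaK r : involutive (alpha r).
Proof. by case=> v h; rewrite /alpha /= mvK. Qed.

Lemma alpha_alpha r s t x :
  uniq [:: r; s; t] -> alpha r (alpha s x) = alpha t x.
Proof. by move=> u; rewrite /alpha /= (mv_mv _ u). Qed.

Lemma E_neq x : E x != x.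
Proof. by apply/eqP => e; have:= E_sign x; rewrite e; case: plusb. Qed.

Lemma srel_sym A : involutive A -> symmetric (srel A).
Proof.
by move=> AK x y; rewrite /srel /= (inv_eq EK) (inv_eq AK) !(eq_sym x).
Qed.

Lemma invf_srelP A (phi : {ffun X -> bool}) :
  reflect ((forall x, phi (E x) = phi x) /\ (forall x, phi (A x) = phi x))
    (phi \in invf (srel A)).
Proof.
apply: (iffP (invfP _ _)) => [H | [H1 H2] x y /orP[]/eqP <- //].
by split=> x; apply/esym/H; rewrite /srel /= eqxx ?orbT.
Qed.

(** Lines match + half-lines with - half-lines, so every line contributes its value twice. *)
Lemma xor_invariant (q : X -> bool) :
  (forall x, q (E x) = q x) -> \xor_(x : X) q x = false.
Proof.
move=> qE; rewrite (bigID (fun x : X => plusb x.2)) /=.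
rewrite [X in _ (+) X](reindex_inj (inv_inj EK)) /=.
rewrite [X in _ (+) X](eq_big (fun x : X => plusb x.2) q) ?addbb //.
by move=> x; rewrite E_sign negbK.
Qed.

Lemma xor_half_lines (q : X -> bool) :
  \xor_(x : X) q x = \xor_(v : V) \xor_(h : 'I_4) q (v, h).
Proof. by rewrite pair_bigA; apply: eq_bigr => -[v h]. Qed.

Lemma xor_point (x0 : X) w : \xor_(h : 'I_4) ((w, h) == x0) = (w == x0.1).
Proof.
case: x0 => v k; case: (eqVneq w v) => [-> | ne] /=; last first.
  by rewrite big1 // => h _; apply/eqP => -[e]; rewrite e eqxx in ne.
rewrite (bigD1 k) //= eqxx big1 // => h ne.
by apply/eqP => -[e]; rewrite e eqxx in ne.
Qed.

(** * Mod 2 chains and cycles of the 4-regular graph *)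

Definition line (x0 : X) : X -> bool := fun x => (x == x0) (+) (x == E x0).

Lemma line_inv x0 x : line x0 (E x) = line x0 x.
Proof. by rewrite /line (inv_eq EK) (inj_eq (inv_inj EK)) addbC. Qed.

Lemma xor_line x0 w :
  \xor_(h : 'I_4) line x0 (w, h) = (w == x0.1) (+) (w == (E x0).1).
Proof. by rewrite big_split /= !xor_point. Qed.

(** [u] is the mod 2 sum of the lines along the path; boundary contributions cancel except at the
    two ends. *)
Lemma avoid_path B a b : connect (avoid B) a b ->
  exists u : X -> bool, [/\ forall x, u (E x) = u x,
    forall x, x.1 \in B -> u x = false &
    forall w, \xor_(h : 'I_4) u (w, h) = (w == a) (+) (w == b)].
Proof.
case/connectP=> p e_p -> {b}; elim: p a e_p => [|c p IHp] a /=.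
  by exists (fun=> false); split=> // w; rewrite big1 ?addbb.
case/andP=> /and3P[aB cB /existsP[h /eqP ec]] /IHp[u [uE uB du]].
exists (fun x => line (a, h) x (+) u x); split=> [x | x xB | w].
- by rewrite line_inv uE.
- rewrite uB // addbF /line.
  have /negbTE -> : x != (a, h) by apply: contraNneq aB => xe; rewrite xe in xB.
  by apply/negbTE; apply: contraNneq cB => xe; rewrite -ec -xe.
- by rewrite big_split /= xor_line du ec /= -addbA addKb.
Qed.

(** The 1-chains of the graph, written on half-lines; [bd] is then the mod 2 boundary map. *)
Definition line_space : {set {ffun X -> bool}} :=
  [set phi : {ffun X -> bool} | [forall x, phi (E x) == phi x]].

Definition bd (phi : {ffun X -> bool}) : {ffun V -> bool} :=
  [ffun w => \xor_(h : 'I_4) phi (w, h)].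

Definition cycle_space : {set {ffun X -> bool}} :=
  [set phi in line_space | bd phi == [ffun=> false]].

Lemma line_spaceP (phi : {ffun X -> bool}) :
  reflect (forall x, phi (E x) = phi x) (phi \in line_space).
Proof.
rewrite inE; apply: (iffP forallP) => H x; first by apply/eqP.
by apply/eqP.
Qed.

Lemma cycle_spaceP (phi : {ffun X -> bool}) :
  reflect ((forall x, phi (E x) = phi x) /\
           (forall w, \xor_(h : 'I_4) phi (w, h) = false))
    (phi \in cycle_space).
Proof.
rewrite inE; apply: (iffP andP) => [[/line_spaceP H /eqP/ffunP d] | [H d]].
  by split=> // w; have:= d w; rewrite !ffunE.
by split; [apply/line_spaceP | apply/eqP/ffunP => w; rewrite !ffunE d].
Qed.

Definition xorf (T : finType) (phi psi : {ffun T -> bool}) : {ffun T -> bool} :=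
  [ffun x => phi x (+) psi x].

Lemma xorfK (T : finType) (phi : {ffun T -> bool}) : involutive (xorf phi).
Proof. by move=> psi; apply/ffunP => x; rewrite !ffunE addKb. Qed.

(** The map [g] has [line_space] both as kernel and as image: a line function [u] is the image of
    its restriction to + half-lines. The square thus counts all functions. *)
Lemma card_line_space : #|line_space| ^ 2 = 2 ^ (4 * #|V|).
Proof.
have <- : #|[set: {ffun X -> bool}]| = 2 ^ (4 * #|V|).
  by rewrite cardsT card_ffun card_bool card_prod card_ord mulnC.
pose g (phi : {ffun X -> bool}) := [ffun x => phi x (+) phi (E x)].
rewrite (@card_fibers _ _ g setT #|line_space|) => [|phi _].
  rewrite expnS expn1; congr (_ * _); apply: eq_card => u.
  apply/idP/imsetP=> [/line_spaceP uE | [phi _ ->]]; last first.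
    by apply/line_spaceP => x; rewrite !ffunE EK addbC.
  exists [ffun x : X => plusb x.2 && u x] => //; apply/ffunP => x.
  by rewrite !ffunE E_sign uE; case: plusb; case: (u x).
rewrite -[RHS](card_imset _ (inv_inj (xorfK phi))); apply: eq_card => psi.
apply/idP/imsetP=> [| [u /line_spaceP uE ->]].
  rewrite inE => /andP[_ /eqP/ffunP e]; exists (xorf phi psi).
    apply/line_spaceP => x; have:= e x; rewrite !ffunE.
    by case: (phi x); case: (phi (E x)); case: (psi x); case: (psi (E x)).
  by rewrite xorfK.
rewrite !inE; apply/eqP/ffunP => x; rewrite !ffunE uE.
by case: (phi x); case: (phi (E x)); case: (u x).
Qed.

Hypothesis conn : forall a b, connect (avoid set0) a b.

(** By connectedness the image contains every sum of two points, hence has index at most 2. *)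
Lemma card_bd_image : 2 ^ #|V| <= 2 * #|bd @: line_space|.
Proof.
have <- : #|[set: {ffun V -> bool}]| = 2 ^ #|V|.
  by rewrite cardsT card_ffun card_bool.
case: (pickP (@predT V)) => [a _ | noV]; last first.
  have le1 : #|[set: {ffun V -> bool}]| <= 1.
    by rewrite cardsT card_ffun card_bool eq_card0.
  apply: leq_trans le1 _; rewrite muln_gt0 /= card_gt0; apply/set0Pn.
  exists (bd [ffun=> false]); apply/imsetP; exists [ffun=> false] => //.
  by apply/line_spaceP => x; rewrite !ffunE.
set I := bd @: line_space.
have Ixor phi psi : phi \in I -> psi \in I -> xorf phi psi \in I.
  case/imsetP=> u /line_spaceP uE -> /imsetP[u' /line_spaceP uE' ->].
  apply/imsetP; exists (xorf u u').
    by apply/line_spaceP => x; rewrite !ffunE uE uE'.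
  apply/ffunP => w; rewrite !ffunE -big_split.
  by apply: eq_bigr => h _; rewrite ffunE.
pose delta b : {ffun V -> bool} := [ffun w => (w == a) (+) (w == b)].
have Idelta b : delta b \in I.
  have [u [uE _ du]] := avoid_path (conn a b).
  apply/imsetP; exists (finfun u).
    by apply/line_spaceP => x; rewrite !ffunE.
  by apply/ffunP => w; rewrite !ffunE -du; apply: eq_bigr => h _; rewrite ffunE.
pose da : {ffun V -> bool} := [ffun w => w == a].
suffices cover : [set: {ffun V -> bool}] \subset I :|: xorf da @: I.
  apply: leq_trans (subset_leq_card cover) _.
  apply: leq_trans (leq_card_setU _ _) _.
  by rewrite mul2n -addnn leq_add2l leq_imset_card.
have I0 : [ffun=> false] \in I.
  have := Idelta a; congr (_ \in I).
  by apply/ffunP => w; rewrite !ffunE addbb.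
(* A function is a sum of points, and the point [b] is [da] plus [delta b]: adding it exchanges [I]
   and its coset. *)
have key (s : seq V) : [ffun w => \big[addb/false]_(b <- s) (w == b)]
    \in I :|: xorf da @: I.
  elim: s => [|b s IHs].
    rewrite inE; apply/orP; left; move: I0; congr (_ \in I).
    by apply/ffunP => w; rewrite !ffunE big_nil.
  have -> : [ffun w => \big[addb/false]_(c <- b :: s) (w == c)] =
      xorf da (xorf (delta b) [ffun w => \big[addb/false]_(c <- s) (w == c)]).
    apply/ffunP => w; rewrite !ffunE big_cons /=.
    by case: (w == a); case: (w == b); case: (\big[_/_]_(_ <- _) _).
  move: IHs; rewrite !inE => /orP[Is | /imsetP[psi Ipsi ->]].
    by apply/orP; right; apply: imset_f; apply: Ixor.
  apply/orP; left; rewrite -[X in X \in I]/(xorf da _).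
  have -> : xorf da (xorf (delta b) (xorf da psi)) = xorf (delta b) psi.
    apply/ffunP => w; rewrite !ffunE.
    by case: (w == a); case: (w == b); case: (psi w).
  exact: Ixor.
apply/subsetP => phi _; have := key (enum [pred b | phi b]).
rewrite (_ : finfun _ = phi) //; apply/ffunP => w; rewrite ffunE big_enum /= big_mkcond /= (bigD1 w) //=.
rewrite eqxx inE big1 ?addbF; first by case: (phi w).
by move=> b ne; rewrite eq_sym (negbTE ne); case: ifP.
Qed.

(** Kernel of [bd]: the chains have dimension 2V and the image has dimension at least V - 1. *)
Lemma card_cycle_space : #|cycle_space| <= 2 ^ #|V|.+1.
Proof.
have e : #|line_space| = #|bd @: line_space| * #|cycle_space|.
  apply: card_fibers => phi /line_spaceP phiE.
  rewrite -[RHS](card_imset _ (inv_inj (xorfK phi))); apply: eq_card => psi.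
  apply/idP/imsetP=> [| [u /cycle_spaceP[uE du] ->]].
    rewrite inE => /andP[/line_spaceP psiE /eqP/ffunP d].
    exists (xorf phi psi); last by rewrite xorfK.
    apply/cycle_spaceP; split=> [x | w]; first by rewrite !ffunE phiE psiE.
    under eq_bigr do rewrite ffunE.
    by rewrite big_split /=; have:= d w; rewrite !ffunE => ->; rewrite addbb.
  rewrite inE; apply/andP; split.
    by apply/line_spaceP => x; rewrite !ffunE phiE uE.
  apply/eqP/ffunP => w; rewrite !ffunE; under eq_bigr do rewrite ffunE.
  by rewrite big_split /= du addbF.
have e2 : #|line_space| = 2 ^ (2 * #|V|).
  apply/eqP; rewrite -(eqn_exp2r _ _ (isT : 0 < 2)).
  by rewrite card_line_space -expnM mulnAC.
have p0 : 0 < 2 ^ #|V| by rewrite expn_gt0.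
rewrite -(leq_pmul2l p0) -expnD addnS expnS addnn -mul2n -e2 e mulnA.
by rewrite leq_mul2r card_bd_image orbT.
Qed.

Definition slot_faces (r : 'I_3) : nat := n_comp (srel (alpha r)) predT.

Lemma card_invf_slot r : #|invf (srel (alpha r))| = 2 ^ slot_faces r.
Proof. exact/card_invf/sym_connect_sym/srel_sym/alphaK. Qed.

Lemma constant_vertex r s (q : X -> bool) : r != s ->
  (forall x, q (alpha r x) = q x) -> (forall x, q (alpha s x) = q x) ->
  forall v h k, q (v, h) = q (v, k).
Proof.
move=> rs qr qs v h; have [t u] := third_slot rs.
apply: (mv_ind (h := h) u) => //; first by rewrite -[RHS]qr /alpha /= mvK.
  by rewrite -[RHS]qs /alpha /= mvK.
rewrite -(mv_mv h u); have:= qr (v, mv s h); rewrite /alpha /= => ->.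
by rewrite -[RHS]qs /alpha /= mvK.
Qed.

Lemma constant_inv r s (q : X -> bool) : r != s ->
  (forall x, q (E x) = q x) ->
  (forall x, q (alpha r x) = q x) -> (forall x, q (alpha s x) = q x) ->
  forall x y, q x = q y.
Proof.
move=> rs qE qr qs [a h] [b k].
have cst := constant_vertex rs qr qs.
have /connectP[p e_p ->] := conn a b.
elim: p a h e_p => [|c p IHp] a h /=; first by move=> _; apply: cst.
case/andP=> /and3P[_ _ /existsP[l /eqP <-]] /(IHp _ (E (a, l)).2) <-.
by rewrite -surjective_pairing qE; apply: cst.
Qed.

Section Euler.

Variables r s : 'I_3.
Hypothesis rs : r != s.

Let pairs := setX (invf (srel (alpha r))) (invf (srel (alpha s))).
Let addp (p : {ffun X -> bool} * {ffun X -> bool}) := xorf p.1 p.2.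

(** At a vertex, a function on slot-[r] faces takes equal values on [h] and [mv r h], so its four
    values sum to zero; likewise for [s]. *)
Let addp_cycle : addp @: pairs \subset cycle_space.
Proof.
apply/subsetP => _ /imsetP[[phi psi] + ->].
rewrite in_setX /= => /andP[/invf_srelP[phiE phir] /invf_srelP[psiE psis]].
apply/cycle_spaceP; split=> [x | w]; first by rewrite !ffunE phiE psiE.
have [t u] := third_slot rs; rewrite (xor4 ord0 _ u) !ffunE -(mv_mv _ u) /=.
have phiv h : phi (w, mv r h) = phi (w, h) by apply: (phir (w, h)).
have psiv h : psi (w, mv s h) = psi (w, h) by apply: (psis (w, h)).
have [u1 _ _] := uniq_slots_sym u.
have <- : phi (w, mv s (mv r ord0)) = phi (w, mv s ord0).
  by rewrite (mv_mv _ u1) -(mv_mv _ u) phiv.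
rewrite (mv_mv _ u) -(mv_mv _ u1) !psiv phiv.
by case: (phi (w, _)); case: (psi (w, ord0)); case: (psi _); case: (phi _).
Qed.

(** If two pairs have the same sum, the difference of the first components equals that of the second
    ones. It is invariant under both slots, hence constant, and each fiber consists of a pair and
    its negation. *)
Let card_pairs : 0 < #|V| -> #|pairs| = #|addp @: pairs| * 2.
Proof.
case/card_gt0P=> a _; apply: card_fibers => -[phi psi].
rewrite in_setX /= => /andP[/invf_srelP[phiE phir] /invf_srelP[psiE psis]].
pose neg (f : {ffun X -> bool}) : {ffun X -> bool} := [ffun x => ~~ f x].
have ne : (phi, psi) != (neg phi, neg psi).
  apply/eqP => -[/ffunP/(_ (a, ord0)) + _]; rewrite ffunE.
  by case: (phi _).
rewrite -[RHS](_ : #|[set (phi, psi); (neg phi, neg psi)]| = 2); last first.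
  by rewrite cards2 ne.
apply: eq_card => -[phi' psi']; rewrite in_set in_setX in_set2 /=.
apply/idP/idP; last first.
  case/orP=> /eqP[-> ->].
    apply/andP; split; last by [].
    by apply/andP; split; apply/invf_srelP.
  apply/andP; split; first apply/andP; first split.
  - by apply/invf_srelP; split=> x; rewrite !ffunE ?phiE ?phir.
  - by apply/invf_srelP; split=> x; rewrite !ffunE ?psiE ?psis.
  - by apply/eqP/ffunP => x; rewrite !ffunE addNb addbN negbK.
case/andP=> /andP[/invf_srelP[phiE' phir'] /invf_srelP[psiE' psis']].
move/eqP/ffunP=> e.
pose d x := phi x (+) phi' x.
have de x : d x = psi x (+) psi' x.
  have:= e x; rewrite !ffunE /d /=.
  by case: (phi x); case: (psi x); case: (phi' x); case: (psi' x).
have cst : forall x y, d x = d y.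
  apply: (constant_inv rs) => x; rewrite /d ?phiE ?phiE' ?phir ?phir' //.
  by rewrite -!/(d _) !de psis psis'.
have dx x : d x = d (a, ord0) by apply: cst.
case: (d (a, ord0)) dx => dx; apply/orP; [right | left]; apply/eqP; congr pair;
  apply/ffunP => x; move: (dx x) (de x); rewrite ?ffunE /d;
  by case: (phi x); case: (psi x); case: (phi' x); case: (psi' x).
Qed.

Let pairs_faces : #|pairs| = 2 ^ (slot_faces r + slot_faces s).
Proof. by rewrite cardsX !card_invf_slot expnD. Qed.

(** The sums of face functions form a space of dimension F_r + F_s - 1 inside a cycle space of
    dimension at most V + 1. *)
Lemma euler_slots : 0 < #|V| -> slot_faces r + slot_faces s <= #|V| + 2.
Proof.
move=> V0; rewrite -(leq_exp2l (m := 2)) // -pairs_faces card_pairs //.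
rewrite addn2 expnSr leq_mul2r /=.
by apply: leq_trans (subset_leq_card addp_cycle) card_cycle_space.
Qed.

(** Equal cardinals turn the inclusion of the face sums in the cycle space into an equality. *)
Lemma planar_exact (u : X -> bool) :
    0 < #|V| -> slot_faces r + slot_faces s = #|V| + 2 ->
    (forall x, u (E x) = u x) ->
    (forall w, \xor_(h : 'I_4) u (w, h) = false) ->
  exists phi psi : {ffun X -> bool}, [/\ phi \in invf (srel (alpha r)),
    psi \in invf (srel (alpha s)) & forall x, u x = phi x (+) psi x].
Proof.
move=> V0 planar uE du.
have e : addp @: pairs = cycle_space.
  apply/eqP; rewrite eqEcard addp_cycle /=.
  apply: leq_trans card_cycle_space _.
  by rewrite -(leq_pmul2r (isT : 0 < 2)) -card_pairs // pairs_faces planar -expnSr addn2.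
have : finfun u \in cycle_space.
  apply/cycle_spaceP; split=> [x | w]; first by rewrite !ffunE.
  by rewrite -[RHS](du w); apply: eq_bigr => h _; rewrite ffunE.
rewrite -e => /imsetP[[phi psi]]; rewrite in_setX /= => /andP[phir psis] /ffunP eu.
by exists phi, psi; split=> // x; have:= eu x; rewrite !ffunE.
Qed.

End Euler.

(* Faces of slot [s] are straight curves in the planar jacket of slots [r] and
   [t]; distinct ones cross an even number of times. *)
Lemma even_crossings r s t n (N : X -> 'I_n) (h : 'I_4) :
    uniq [:: r; s; t] -> 0 < #|V| -> slot_faces r + slot_faces t = #|V| + 2 ->
    (forall x, N (E x) = N x) -> (forall x, N (alpha s x) = N x) ->
  ~~ odd #|[pred v | N (v, h) != N (v, mv t h)]|.
Proof.
move=> u V0 planar NE Ns.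
have [u1 u2 u3] := uniq_slots_sym u.
have rt : r != t by move: u2; rewrite /= inE negb_or => /andP[/andP[]].
(* Jordan curves: the faces of the planar jacket are coloured so that the two colours beside a
   half-line differ exactly on curve [k]. Here [phi] colours the slot-[r] faces, and going straight
   through a vertex changes it when exactly one of the two strands crossing there belongs to curve
   [k]. *)
have ex (k : 'I_n) : exists phi : {ffun X -> bool},
    (forall x, phi (E x) = phi x) /\
    forall x, phi x (+) phi (alpha s x) = (N x == k) (+) (N (alpha t x) == k).
  have [|w|phi [psi [/invf_srelP[phiE phir] /invf_srelP[_ psit] e]]] :=
    planar_exact (u := fun x => N x == k) rt V0 planar.
  - by move=> x; rewrite NE.
  - have Nw l : N (w, mv s l) = N (w, l) by apply: (Ns (w, l)).
    rewrite (xor4 ord0 _ u1) Nw addbb /=.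
    by rewrite -(mv_mv _ u1) Nw addbb.
  exists phi; split=> // x; rewrite !e psit -(alpha_alpha _ u2) phir.
  by rewrite addbACA addbb addbF.
have {ex} [phi phiP] := fin_all_exists ex.
(* Only curves of smaller label count, so [q] changes along a curve exactly where it crosses a curve
   of smaller label. Each crossing of distinct curves is thus seen once. *)
pose q x := \xor_(k : 'I_n) ((k < N x) && phi k x).
have qE x : q (E x) = q x.
  by apply: eq_bigr => k _; rewrite NE (phiP k).1.
have qs x : q x (+) q (alpha s x) = (N (alpha t x) < N x).
  rewrite /q -big_split /= Ns.
  under eq_bigr => k _ do rewrite -andb_addr (phiP k).2.
  case: ltnP => [lt | le]; last first.
    apply: big1 => k _; case: ltnP => //= lt.
    by rewrite -!val_eqE /= (gtn_eqF lt) (gtn_eqF (leq_trans lt le)).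
  rewrite (bigD1 (N (alpha t x))) //= lt eqxx big1 => [|k ne].
    by rewrite -val_eqE /= (gtn_eqF lt).
  case: ltnP => //= lt'; rewrite -val_eqE /= (gtn_eqF lt').
  by rewrite eq_sym (negbTE ne).
have := xor_invariant qE; rewrite xor_half_lines.
rewrite (eq_bigr (fun v => N (v, h) != N (v, mv t h))) => [|v _].
  by rewrite xor_sum_odd => ->.
have [_ u4 _] := uniq_slots_sym u1.
rewrite (xor4 h _ u4) -addbA.
have:= qs (v, h); rewrite /alpha /= => ->.
have:= qs (v, mv t h); rewrite /alpha /= mvK (mv_mv _ u4) => ->.
by rewrite -val_eqE /=; case: ltngtP.
Qed.

(** The slot-[s] faces, numbered by their roots, serve as the curves of [even_crossings]; if every
    vertex lay on two distinct ones, the number of vertices would be even. *)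
Lemma self_crossing r s t :
    uniq [:: r; s; t] -> odd #|V| -> slot_faces r + slot_faces t = #|V| + 2 ->
  exists v, forall h k, connect (srel (alpha s)) (v, h) (v, k).
Proof.
move=> u oddV planar.
have V0 : 0 < #|V| by apply: odd_gt0.
have sym := sym_connect_sym (srel_sym (alphaK s)).
pose N (x : X) := enum_rank (fingraph.root (srel (alpha s)) x).
have Nc x y : connect (srel (alpha s)) x y = (N x == N y).
  by rewrite /N (inj_eq enum_rank_inj) root_connect.
have Ns x : N (alpha s x) = N x.
  by apply/eqP; rewrite -Nc sym connect1 // /srel /= eqxx orbT.
have NE x : N (E x) = N x.
  by apply/eqP; rewrite -Nc sym connect1 // /srel /= eqxx.
have := even_crossings ord0 u V0 planar NE Ns.
case: (pickP [pred v | N (v, ord0) == N (v, mv t ord0)]) => [v /eqP ve _ | no].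
  exists v => h k; suff cst l : N (v, l) = N (v, ord0) by rewrite Nc !cst.
  have Nv l' : N (v, mv s l') = N (v, l') by apply: (Ns (v, l')).
  have [_ _ u3] := uniq_slots_sym u; have [u4 _ _] := uniq_slots_sym u3.
  move: l; apply: (mv_ind (h := ord0) u4) => //.
  by rewrite -(mv_mv _ u4) Nv.
have -> : #|[pred v | N (v, ord0) != N (v, mv t ord0)]| = #|V|.
  by apply: eq_card => v; have := no v; rewrite !inE /= => ->.
by rewrite oddV.
Qed.

(** In the decomposition of the cycle [u] into faces, the slot-[s] part is constant at [v] by
    [same], and the slot-[r] part agrees on [h] and [mv r h]. *)
Lemma separated_cycle r s v (u : X -> bool) h : r != s -> 0 < #|V| ->
    slot_faces r + slot_faces s = #|V| + 2 ->
    (forall h k, connect (srel (alpha s)) (v, h) (v, k)) ->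
    (forall x, u (E x) = u x) ->
    (forall w, \xor_(h : 'I_4) u (w, h) = false) ->
  u (v, mv r h) = u (v, h).
Proof.
move=> rs V0 planar same uE du.
have [phi [psi [/invf_srelP[_ phir] psis e]]] := planar_exact rs V0 planar uE du.
by rewrite !e (invf_connect psis (same (mv r h) h)) (phir (v, h)).
Qed.

Section Separation.

Variables (r s : 'I_3) (v : V).
Hypotheses (rs : r != s) (V0 : 0 < #|V|).
Hypothesis planar : slot_faces r + slot_faces s = #|V| + 2.
Hypothesis same : forall h k, connect (srel (alpha s)) (v, h) (v, k).

(** A loop at [v] is itself a cycle, using only [h] and [k] there. *)
Lemma separated_loop h k : E (v, h) = (v, k) -> k = mv r h.
Proof.
move=> e; apply/eqP; apply: contraT => ne.
have dl w : \xor_(l : 'I_4) line (v, h) (w, l) = false.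
  by rewrite xor_line e addbb.
have := separated_cycle h rs V0 planar same (line_inv (v, h)) dl.
have /negbTE vhk : (v, h) != (v, k) by rewrite -e eq_sym E_neq.
rewrite /line e vhk !xpair_eqE !eqxx /= (negbTE (mv_neq _ _)).
by rewrite eq_sym (negbTE ne).
Qed.

(** The path and the two lines joining it to [v] form a cycle that uses only [h] and [k] at [v]. *)
Lemma separated_path h k :
    (E (v, h)).1 != v -> (E (v, k)).1 != v ->
    connect (avoid [set v]) (E (v, h)).1 (E (v, k)).1 ->
  k = h \/ k = mv r h.
Proof.
move=> hv kv /avoid_path[u [uE uv du]].
case: (eqVneq k h) => [-> | kh]; first by left.
case: (eqVneq k (mv r h)) => [-> | kr]; first by right.
pose w x := line (v, h) x (+) line (v, k) x (+) u x.
have wE x : w (E x) = w x by rewrite /w !line_inv uE.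
have dw a : \xor_(l : 'I_4) w (a, l) = false.
  rewrite /w big_split /= big_split /= !xor_line du.
  by case: (a == v); case: (a == _); case: (a == _).
have := separated_cycle h rs V0 planar same wE dw.
have uv0 l : u (v, l) = false by apply: uv; rewrite inE.
have ne l m : (E (v, m)).1 != v -> ((v, l) == E (v, m)) = false.
  by move=> nm; apply/negbTE; apply: contraNneq nm => <-.
rewrite /w /line !uv0 !ne // !xpair_eqE !eqxx /= (negbTE (mv_neq _ _)).
by rewrite ![_ == k]eq_sym (negbTE kh) (negbTE kr).
Qed.

End Separation.

End LineInvolution.

(** * Faces by slot and the degree of a vacuum graph *)

Lemma sum_slots (F : 'I_3 -> nat) r s t :
  uniq [:: r; s; t] -> \sum_(i < 3) F i = F r + F s + F t.
Proof.
move=> u; rewrite (perm_big [:: r; s; t]).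
  by rewrite !big_cons big_nil /= addn0 addnA.
apply: (uniq_perm (index_enum_uniq _) u) => k; rewrite mem_index_enum.
have sub : {subset [:: r; s; t] <= enum 'I_3} by move=> x _; rewrite mem_enum.
have [] := uniq_min_size u sub; first by rewrite size_enum_ord.
by move=> _ ->; rewrite mem_enum.
Qed.

(** The three pair sums add up to [3 * (n + 2) - 1], so exactly one falls short, by one; [r] is the
    slot common to the other two pairs. *)
Lemma planar_jackets (F : 'I_3 -> nat) n :
    (forall r s, r != s -> F r + F s <= n + 2) ->
    2 * (\sum_(i < 3) F i) = 5 + 3 * n ->
  odd n /\ exists r s t, [/\ uniq [:: r; s; t], F r + F s = n + 2 &
    F r + F t = n + 2].
Proof.
pose a : 'I_3 := inord 0; pose b : 'I_3 := inord 1; pose c : 'I_3 := inord 2.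
move=> le; have u : uniq [:: a; b; c] by rewrite /= !inE -!val_eqE /= !inordK.
have [u1 u2 u3] := uniq_slots_sym u; have [_ u4 _] := uniq_slots_sym u3.
rewrite (sum_slots F u).
have [ab bc ac] : [/\ a != b, b != c & a != c] by rewrite -!val_eqE /= !inordK.
move: (le _ _ ab) (le _ _ bc) (le _ _ ac) => le1 le2 le3 e.
split; first by lia.
have [h|[h|h]] : F a + F b < n + 2 \/ F b + F c < n + 2 \/ F a + F c < n + 2.
- by lia.
- by exists c, a, b; split; [have [_ _] := uniq_slots_sym u1 | lia | lia].
- by exists a, b, c; split; [ | lia | lia].
- by exists b, a, c; split; [ | lia | lia].
Qed.

Section VacuumGraph.

Variable G : sgraph.
Hypothesis vacG : vacuum G.

Definition lineof (H : sgraph) (x : vtx H * 'I_4) := odflt x (lnk H x).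
Local Notation E := (@lineof G).

Lemma lnk_lineof x : lnk G x = Some (E x).
Proof. by rewrite /lineof; case: vacG => _ /(_ x); case: (lnk G x). Qed.

Lemma lineofK : involutive E.
Proof.
move=> x; have [ok _ _] := vacG; have [+ _] := ok _ _ (lnk_lineof x).
by rewrite lnk_lineof => -[].
Qed.

Lemma lineof_sign x : plusb (E x).2 = ~~ plusb x.2.
Proof.
have [ok _ _] := vacG; have [_] := ok _ _ (lnk_lineof x).
by case: plusb; case: plusb.
Qed.

Lemma vacuum_avoid a b : connect (avoid E set0) a b.
Proof.
have [_ _ [_ /(_ a b)]] := vacG; rewrite (eq_connect (e' := avoid E set0)) //.
move=> v w; rewrite /avoid /= !inE /=; apply/existsP/existsP => -[h].
  by case/existsP=> k; rewrite lnk_lineof => /eqP[e]; exists h; rewrite e.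
move/eqP=> e; exists h; apply/existsP; exists (E (v, h)).2.
by rewrite lnk_lineof -e -surjective_pairing.
Qed.

Lemma vacuum_card : 0 < #|vtx G|.
Proof. by have [_ _ [V0 _]] := vacG. Qed.

Lemma face_relE z z' : face_rel G z z' =
  (z.2 == z'.2) && srel E (alpha z.2) z.1 z'.1.
Proof.
case: z z' => [[v h] r] [[w k] r'].
rewrite /face_rel /srel /alpha lnk_lineof /= vstrandE -pair_eqE /= !xpair_eqE.
rewrite -[Some _ == _]/(E (v, h) == (w, k)).
by case: (eqVneq r r') => _; rewrite ?andbT ?andbF //= orbC.
Qed.

(** Strands never change slot, so the face graph is a disjoint union of three graphs, each
    isomorphic to the [srel] of its slot. *)
Lemma nfaces_slots : nfaces G = \sum_(r < 3) slot_faces E r.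
Proof.
have symr r : symmetric (srel E (alpha r)).
  exact/srel_sym/alphaK/lineofK.
have sym : symmetric (face_rel G).
  move=> x y; rewrite !face_relE eq_sym; case: eqP => //= ->; exact: symr.
rewrite /nfaces /n_comp_mem -sum1_card.
rewrite (partition_big (fun z : vtx G * 'I_4 * 'I_3 => z.2) predT) //=.
apply: eq_bigr => r _; rewrite sum1_card.
pose a := [pred z : vtx G * 'I_4 * 'I_3 | z.2 == r].
have -> : #|[pred z | (z \in predI (roots (face_rel G)) predT) && (z.2 == r)]|
    = n_comp (face_rel G) a.
  by apply: eq_card => z; rewrite !inE andbT.
have cl : closed (face_rel G) a.
  by move=> z z'; rewrite face_relE !inE => /andP[/eqP -> _].
have adj : rel_adjunction (fun x => (x, r)) (face_rel G) (srel E (alpha r)) a.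
  apply: strict_adjunction => //; first exact: sym_connect_sym.
  - by move=> x y [].
  - by apply/subsetP => -[x r'] /eqP /= ->; apply: codom_f.
  - by move=> x y _; rewrite face_relE /= eqxx.
rewrite (adjunction_n_comp _ _ _ cl adj); [ | exact: sym_connect_sym ..].
by apply: eq_n_comp_r => x; rewrite !inE eqxx.
Qed.

Lemma vacuum_euler r s : r != s ->
  slot_faces E r + slot_faces E s <= #|vtx G| + 2.
Proof.
move=> rs; apply: euler_slots => //; [exact: lineofK | exact: lineof_sign | | ].
  exact: vacuum_avoid.
exact: vacuum_card.
Qed.

(** Degree without denominators: [n = 5] means degree 1/2 and [n = 6] means degree 0. *)
Lemma degreeP n : (degree G = 3 - n%:R / 2)%R <->
  2 * nfaces G = 3 * #|vtx G| + n.
Proof.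
rewrite /degree; split=> [e | e].
  apply/eqP; rewrite -(eqr_nat rat) natrD !natrM; apply/eqP; lra.
have : ((2 * nfaces G)%:R = (3 * #|vtx G| + n)%:R :> rat)%R by rewrite e.
rewrite natrD !natrM => e'; lra.
Qed.

(** Sum of Euler's bounds for the three jackets: the degree is nonnegative. *)
Lemma degree_ge0 : 2 * nfaces G <= 3 * #|vtx G| + 6.
Proof.
pose a : 'I_3 := inord 0; pose b : 'I_3 := inord 1; pose c : 'I_3 := inord 2.
have u : uniq [:: a; b; c] by rewrite /= !inE -!val_eqE /= !inordK.
rewrite nfaces_slots (sum_slots _ u).
have [ab bc ac] : [/\ a != b, b != c & a != c] by rewrite -!val_eqE /= !inordK.
move: (vacuum_euler ab) (vacuum_euler bc) (vacuum_euler ac); lia.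
Qed.

End VacuumGraph.

(** * Pieces hanging at a separating vertex *)

Definition slot0 : 'I_3 := @Ordinal 3 0 isT.
Definition slot1 : 'I_3 := @Ordinal 3 1 isT.
Definition slot2 : 'I_3 := @Ordinal 3 2 isT.

(** A bare line closes up to a circle with one face in each slot. This fits degree 0 with no vertex,
    since [2 * 3 = 3 * 0 + 6]. *)
Definition piece_faces (o : option tpg) (s : 'I_3) : nat :=
  if o is Some M then slot_faces (@lineof (tp_closure M)) s else 1.

Definition unfold_end (V : finType) (v : V) (o : option tpg) (g : vo o -> V)
    (z : (vo o * 'I_4) + 'I_4) : V * 'I_4 :=
  match z with inl x => (g x.1, x.2) | inr h => (v, h) end.

(* Smoothing [v]: its half-lines are joined as by the strands of slot 0, so that
   the graph falls apart at [v]. *)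
Definition smooth (V : finType) (v : V) (s : 'I_3) (x : V * 'I_4) :=
  if x.1 == v then alpha slot0 x else alpha s x.

Section Side.

Variable G : sgraph.
Hypothesis vacG : vacuum G.
Local Notation V := (vtx G).
Local Notation E := (@lineof G).

Variables (v : V) (K : {set V}) (a b : 'I_4).
Hypotheses (a_plus : plusb a) (ab : b = mv slot0 a) (vK : v \notin K).
Hypothesis K_E : forall x, x.1 \in K ->
  [\/ (E x).1 \in K, x = E (v, a) | x = E (v, b)].
Hypothesis K_conn : forall w, w \in K ->
  connect (avoid E [set v]) (E (v, a)).1 w \/
  connect (avoid E [set v]) (E (v, b)).1 w.

Let EK := lineofK vacG.
Let Esgn := lineof_sign vacG.

Definition side (x : V * 'I_4) := [|| x.1 \in K, x == (v, a) | x == (v, b)].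

Definition side_inv s : {set {ffun V * 'I_4 -> bool}} :=
  [set phi in invf (srel E (smooth v s)) | [forall x, ~~ side x ==> ~~ phi x]].

Lemma side_invP s (phi : {ffun V * 'I_4 -> bool}) : phi \in side_inv s ->
  [/\ forall x, phi (E x) = phi x, forall x, x.1 != v -> phi (alpha s x) = phi x,
      phi (v, b) = phi (v, a) & forall x, ~~ side x -> phi x = false].
Proof.
rewrite inE => /andP[/invf_srelP[phiE phiS] /forallP sup]; split=> // [x xv||x nx].
- by rewrite -[RHS]phiS /smooth (negbTE xv).
- by rewrite -[RHS]phiS /smooth eqxx ab.
- by apply/negbTE; move/implyP: (sup x); apply.
Qed.

(** The first half identifies [o] with the part of the graph on [K], lines included. The second half
    bounds the faces of the smoothed side by those of the closure, states that the degree of the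
    closure is nonnegative, and makes degree 0 give a melonic piece. *)
Definition piece_spec (o : option tpg) (g : vo o -> V) : Prop :=
  [/\ injective g, forall w, w \in K <-> exists z, g z = w &
   [/\ unfold_end v g (endm o b) = E (v, a),
       unfold_end v g (endp o a) = E (v, b) &
       forall z h, unfold_end v g (glue o a b (z, h)) = E (g z, h)]] /\
  [/\ forall s, #|side_inv s| <= 2 ^ piece_faces o s,
      2 * (\sum_(s < 3) piece_faces o s) <= 3 * #|K| + 6 &
      2 * (\sum_(s < 3) piece_faces o s) = 3 * #|K| + 6 -> melonic2 o].

Lemma bare_piece : E (v, a) = (v, b) -> K = set0 -> exists o g, @piece_spec o g.
Proof.
move=> Eab K0; have Eba : E (v, b) = (v, a) by rewrite -Eab EK.
exists None, (fun z : void => match z with end); split; split=> //.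
- by move=> w; rewrite K0 inE; split=> // -[[]].
(* The support shrinks to [(v, a)] and [(v, b)], where the values agree: one bit, for the single
   face of a bare line. *)
- move=> s; have <- : #|{: bool}| = 2 ^ piece_faces None s by rewrite card_bool.
  rewrite -(card_in_imset (f := fun phi : {ffun _ -> bool} => phi (v, a))).
    exact: max_card.
  move=> phi psi /side_invP[_ _ eb sup] /side_invP[_ _ eb' sup'] e.
  apply/ffunP => x; case: (boolP (side x)) => [|nx]; last by rewrite sup ?sup'.
  by rewrite /side K0 inE => /or3P[//|/eqP -> //|/eqP ->]; rewrite eb eb'.
- by rewrite /piece_faces sum_nat_const card_ord K0 cards0.
Qed.

Section Proper.

Hypotheses (Ka : (E (v, a)).1 \in K) (Kb : (E (v, b)).1 \in K).

Let T : finType := {w : V | w \in K}.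
Let emb (x : T * 'I_4) : V * 'I_4 := (val x.1, x.2).

(** [insub] cuts the lines that leave [K]. As [a] is + and [b] is -, the external + end is the
    partner of [(v, b)] and the external - end that of [(v, a)]. *)
Definition piece : tpg :=
  @TPG (@SGraph T (fun x => omap (fun w => (w, (E (emb x)).2))
                              (insub (E (emb x)).1)))
    (Sub (E (v, b)).1 Kb, (E (v, b)).2) (Sub (E (v, a)).1 Ka, (E (v, a)).2).

Let M := piece.

Let emb_inj : injective emb.
Proof. by case=> x h [y k] [/val_inj -> ->]. Qed.

Let emb_xp : emb (xp M) = E (v, b).
Proof. by rewrite /emb /= -surjective_pairing. Qed.

Let emb_xm : emb (xm M) = E (v, a).
Proof. by rewrite /emb /= -surjective_pairing. Qed.

Let lnkP x : if lnk (tg M) x is Some y then emb y = E (emb x)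
  else (E (emb x)).1 \notin K.
Proof.
rewrite /M /=; case: insubP => [w _ e | ] //=.
by rewrite /emb /= e -surjective_pairing.
Qed.

Let lnk_some x y : emb y = E (emb x) -> lnk (tg M) x = Some y.
Proof.
move=> e; have := lnkP x; case: (lnk (tg M) x) => [y' | ].
  by rewrite -e => /emb_inj ->.
by rewrite -e; case: y {e} => -[w Hw] h; rewrite /= Hw.
Qed.

Let xp_plus : plusb (xp M).2.
Proof. by rewrite Esgn ab plusb_mv /= a_plus. Qed.

Let xm_minus : ~~ plusb (xm M).2.
Proof. by rewrite Esgn a_plus. Qed.

Let xp_xm : xp M != xm M.
Proof. by apply: contraNneq xm_minus => <-. Qed.

Let lnk_xp : lnk (tg M) (xp M) = None.
Proof.
have := lnkP (xp M); case: (lnk _ _) => [[w h]|//].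
rewrite emb_xp EK => -[e _]; by move: vK (valP w); rewrite /= e => /negbTE ->.
Qed.

Let lnk_xm : lnk (tg M) (xm M) = None.
Proof.
have := lnkP (xm M); case: (lnk _ _) => [[w h]|//].
rewrite emb_xm EK => -[e _]; by move: vK (valP w); rewrite /= e => /negbTE ->.
Qed.

Let lnk_none x : lnk (tg M) x = None -> x = xp M \/ x = xm M.
Proof.
move=> e; have := lnkP x; rewrite e => nK.
case: (@K_E (emb x)) => [|H|H|H]; first exact: (valP x.1).
- by rewrite H in nK.
- by right; apply: emb_inj; rewrite emb_xm.
- by left; apply: emb_inj; rewrite emb_xp.
Qed.

Lemma piece_two_point : two_point M.
Proof.
split=> // x y e; have := lnkP x; rewrite e => ey.
split; first by apply: lnk_some; rewrite ey EK.
by have := Esgn (emb x); rewrite -ey /= => ->; case: plusb.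
Qed.

Let C := tp_closure M.

Let lnkC x : lnk C x = if x == xp M then Some (xm M)
  else if x == xm M then Some (xp M) else lnk (tg M) x.
Proof. by []. Qed.

(** By [K_E] a line from [K] that avoids [v] stays in [K]. It does not start at an external
    half-line, so the closure keeps it. *)
Let step w w' : avoid E [set v] w w' -> forall Hw : w \in K,
  exists Hw' : w' \in K, adjv C (Sub w Hw) (Sub w' Hw').
Proof.
rewrite /avoid /= !inE => /and3P[_ w'v /existsP[h /eqP e]] Hw.
have Hw' : w' \in K.
  case: (@K_E (w, h) Hw) => [|H|H]; first by rewrite e.
    by move: w'v; rewrite -e H EK eqxx.
  by move: w'v; rewrite -e H EK eqxx.
exists Hw'; apply/existsP; exists h; apply/existsP; exists (E (w, h)).2.
have l : lnk (tg M) (Sub w Hw, h) = Some (Sub w' Hw', (E (w, h)).2).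
  by apply: lnk_some; rewrite /emb /= -e -surjective_pairing.
apply/eqP; rewrite lnkC.
case: eqP => [e' | _]; first by rewrite e' lnk_xp in l.
by case: eqP => [e' | _]; [rewrite e' lnk_xm in l | rewrite l].
Qed.

Let reach w w' : connect (avoid E [set v]) w w' -> forall Hw : w \in K,
  exists Hw' : w' \in K, connect (adjv C) (Sub w Hw) (Sub w' Hw').
Proof.
case/connectP=> p + -> {w'}; elim: p w => [|c p IHp] w /= e_p Hw.
  by exists Hw; apply: connect0.
case/andP: e_p => /step/(_ Hw)[Hc e] /IHp/(_ Hc)[Hl con].
by exists Hl; apply: connect_trans con; apply: connect1.
Qed.

Let lines_okC : lines_ok C.
Proof.
have [ok _ _ _ _] := piece_two_point.
move=> x y; rewrite !lnkC; case: eqP => [-> [<-] | xn].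
  rewrite eq_sym (negbTE xp_xm) eqxx; split=> //.
  by rewrite xp_plus (negbTE xm_minus).
case: eqP => [-> [<-] | xn'].
  by rewrite eqxx; split=> //; rewrite xp_plus (negbTE xm_minus).
move=> /ok[e ->]; split=> //; case: eqP => [ey | _]; first by rewrite ey lnk_xp in e.
by case: eqP => [ey | _]; first by rewrite ey lnk_xm in e.
Qed.

Lemma piece_vacuum : vacuum C.
Proof.
split=> //.
  move=> x; rewrite lnkC; case: eqP => // xn; case: eqP => // xn'.
  by move/lnk_none => [].
split; first by apply/card_gt0P; exists (xp M).1.
have symC : connect_sym (adjv C).
  apply: sym_connect_sym => x y; apply/existsP/existsP => -[h] /existsP[k].
    by move/eqP/lines_okC => [e _]; exists k; apply/existsP; exists h; apply/eqP.
  by move/eqP/lines_okC => [e _]; exists k; apply/existsP; exists h; apply/eqP.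
(* Every vertex is reached from one of the two ends by [K_conn], and the closing line joins these
   ends. *)
have base (w : vtx C) : connect (adjv C) (xm M).1 w.
  case: w => w Hw; case: (K_conn Hw).
    move=> /reach/(_ Ka)[Hw' con]; apply: connect_trans con _.
    by apply: eq_connect0; apply: val_inj.
  move=> /reach/(_ Kb)[Hw' con]; apply: connect_trans (connect1 _) _; last first.
    apply: connect_trans con _; apply: eq_connect0; exact: val_inj.
  apply/existsP; exists (xm M).2; apply/existsP; exists (xp M).2.
  apply/eqP; rewrite -!surjective_pairing lnkC.
  by rewrite eq_sym (negbTE xp_xm) eqxx.
by move=> x y; apply: connect_trans (base y); rewrite symC.
Qed.

Let card_T : #|vtx C| = #|K|.
Proof. exact: card_sig. Qed.

(** Restriction to [K] lands in the face functions of the closure: smoothing forces equal values at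
    [(v, a)] and [(v, b)], hence at both ends of the closing line. It is injective because lines
    carry the values at [v] into [K]. *)
Lemma piece_side_inv s : #|side_inv s| <= 2 ^ slot_faces (@lineof C) s.
Proof.
rewrite -card_invf_slot; last exact: lineofK piece_vacuum.
pose f (phi : {ffun V * 'I_4 -> bool}) : {ffun vtx C * 'I_4 -> bool} :=
  [ffun y => phi (emb y)].
rewrite -(card_in_imset (f := f)).
  apply/subset_leq_card/subsetP => _ /imsetP[phi /side_invP[phiE phiS eb _] ->].
  apply/invf_srelP; split=> [y | y]; rewrite !ffunE.
    have := lnk_lineof piece_vacuum y; rewrite lnkC.
    case: eqP => [-> [<-] | yn]; first by rewrite emb_xp emb_xm !phiE.
    case: eqP => [-> [<-] | yn']; first by rewrite emb_xp emb_xm !phiE.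
    by move=> e; have := lnkP y; rewrite e => ->.
  rewrite -[RHS]phiS //=.
  by apply: contraNneq vK => <-; exact: (valP y.1).
move=> phi psi /side_invP[phiE _ eb sup] /side_invP[psiE _ eb' sup'] /ffunP e.
have eK x : x.1 \in K -> phi x = psi x.
  by case: x => w h /= Hw; have := e (Sub w Hw, h); rewrite !ffunE.
have ea : phi (v, a) = psi (v, a) by rewrite -phiE -psiE eK.
apply/ffunP => x; case: (boolP (side x)) => [|nx]; last by rewrite sup ?sup'.
by case/or3P=> [/eK | /eqP -> | /eqP ->] //; rewrite eb eb'.
Qed.

Lemma proper_piece : exists o g, @piece_spec o g.
Proof.
exists (Some M), (val : T -> V); split; split.
- exact: val_inj.
- move=> w; split=> [Hw | [z <-]]; last exact: (valP z).
  by exists (Sub w Hw).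
- split=> [||z h]; [exact: emb_xm | exact: emb_xp |].
  rewrite /glue -/M; have := lnkP (z, h); case e: (lnk _ _) => [y|] //= _.
  case: eqP => [e' | ne].
    by rewrite -[E _]/(E (emb (z, h))) e' emb_xp EK.
  case: (lnk_none e) => // e'.
  by rewrite -[E _]/(E (emb (z, h))) e' emb_xm EK.
- exact: piece_side_inv.
- have := degree_ge0 piece_vacuum; rewrite nfaces_slots; last exact: piece_vacuum.
  by rewrite card_T.
- move=> e; split; [exact: piece_two_point | exact: piece_vacuum |].
  have -> : (0 = 3 - 6%:R / 2 :> rat)%R by lra.
  apply/degreeP; rewrite nfaces_slots; last exact: piece_vacuum.
  by rewrite card_T.
Qed.

End Proper.

Hypothesis K_ab : E (v, a) = (v, b) /\ K = set0 \/
  (E (v, a)).1 \in K /\ (E (v, b)).1 \in K.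

Lemma piece_exists : exists o g, @piece_spec o g.
Proof.
by case: K_ab => -[]; [exact: bare_piece | exact: proper_piece].
Qed.

Lemma side_E x : side (E x) = side x.
Proof.
have sub y : side y -> side (E y).
  case/or3P=> [Hy | /eqP -> | /eqP ->].
  - case: (K_E Hy) => [H | -> | ->]; last 2 first.
    + by rewrite /side EK eqxx orbT.
    + by rewrite /side EK eqxx !orbT.
    + by rewrite /side H.
  - case: K_ab => [[-> _] | [H _]]; last by rewrite /side H.
    by rewrite /side eqxx !orbT.
  - case: K_ab => [[e _] | [_ H]]; last by rewrite /side H.
    by rewrite -e EK /side eqxx !orbT.
by apply/idP/idP => /sub //; rewrite EK.
Qed.

(** [mv slot0] preserves the pair [a], [b]. Together with [side_E] this makes the indicator of a
    side an invariant function of the smoothed graph. *)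
Lemma side_smooth s x : side (smooth v s x) = side x.
Proof.
case: x => w h; rewrite /smooth /side /alpha; case: eqP => /= [-> | /eqP wv].
  rewrite (negbTE vK) !xpair_eqE !eqxx /= ab (inj_eq (inv_inj (mvK _))).
  by rewrite (inv_eq (mvK _)) orbC.
by rewrite !xpair_eqE (negbTE wv).
Qed.

(* The faces entering one side must leave it again, hence a slot-[s] face
   through [(v, a)] also runs through [(v, b)]. *)
Lemma side_same_face s (phi : V * 'I_4 -> bool) :
    (forall x, phi (E x) = phi x) -> (forall x, phi (alpha s x) = phi x) ->
  phi (v, b) = phi (v, a).
Proof.
move=> phiE phis; pose q x := side x && phi x.
have qE x : q (E x) = q x by rewrite /q side_E phiE.
have [t] : exists t : 'I_3, s != t.
  by case: (eqVneq s slot0) => [-> | ]; [exists slot1 | exists slot0].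
case/third_slot => r u.
(* Slot [s] pairs the half-lines at each vertex of [K], which therefore contributes zero; at [v]
   only [a] and [b] remain. *)
have := xor_invariant EK Esgn qE; rewrite xor_half_lines (bigD1 v) //=.
rewrite [X in _ (+) X]big1 => [|w wv]; last first.
  rewrite (xor4 ord0 _ u) /q /side !xpair_eqE (negbTE wv) /= !orbF.
  case: (w \in K) => //=.
  have phiv h : phi (w, mv s h) = phi (w, h) by apply: (phis (w, h)).
  by rewrite -(mv_mv _ u) !phiv addbb addFb addbb.
rewrite addbF (bigD1 a) //= (bigD1 b) /=; last by rewrite ab mv_neq.
rewrite big1 => [|h /andP[ha hb]]; last first.
  by rewrite /q /side !xpair_eqE (negbTE ha) (negbTE hb) (negbTE vK) !andbF.
rewrite /q /side !eqxx !orbT /= addbF.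
by case: (phi (v, a)); case: (phi (v, b)).
Qed.

End Side.

(** * The two sides of a self-crossing vertex *)

Section Separating.

Variable G : sgraph.
Hypothesis vacG : vacuum G.
Local Notation V := (vtx G).
Local Notation E := (@lineof G).

Variables (v : V) (r s : 'I_3).
Hypothesis rs : r != s.
Hypothesis planar : slot_faces E r + slot_faces E s = #|V| + 2.
Hypothesis same : forall h k, connect (srel E (alpha s)) (v, h) (v, k).

Let EK := lineofK vacG.
Let Esgn := lineof_sign vacG.
Local Notation av := (avoid E [set v]).

Let loop h k : E (v, h) = (v, k) -> k = mv r h.
Proof.
exact: (separated_loop EK Esgn (vacuum_avoid vacG) rs (vacuum_card vacG) planar same).
Qed.

Let sep h k : (E (v, h)).1 != v -> (E (v, k)).1 != v ->
  connect av (E (v, h)).1 (E (v, k)).1 -> k = h \/ k = mv r h.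
Proof.
exact: (separated_path EK Esgn (vacuum_avoid vacG) rs (vacuum_card vacG) planar same).
Qed.

Definition side_vertices (h : 'I_4) : {set V} :=
  [set w | (w != v) && (connect av (E (v, h)).1 w ||
                        connect av (E (v, mv r h)).1 w)].

Lemma side_verticesP h w : reflect
  (w != v /\ exists k, (k = h \/ k = mv r h) /\ connect av (E (v, k)).1 w)
  (w \in side_vertices h).
Proof.
rewrite inE; apply: (iffP andP) => [[wv /orP[] c] | [wv [k [[] ->]]]] .
- by split=> //; exists h; split; [left|].
- by split=> //; exists (mv r h); split; [right|].
- by move=> ->.
- by move=> ->; rewrite orbT.
Qed.

Let av_sym : connect_sym av.
Proof.
have sub x y : av x y -> av y x.
  case/and3P=> xv yv /existsP[h /eqP e]; apply/and3P; split=> //.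
  apply/existsP; exists (E (x, h)).2.
  by rewrite -e -surjective_pairing EK.
by apply: sym_connect_sym => x y; apply/idP/idP; apply: sub.
Qed.

Let av_v w : connect av v w -> w = v.
Proof.
case/connectP=> -[|c p] /=; first by move=> _ ->.
by rewrite /avoid /= !inE eqxx.
Qed.

Let near k w : w != v -> connect av (E (v, k)).1 w -> (E (v, k)).1 != v.
Proof. by move=> wv; apply: contraTneq => ->; apply: contraNN wv => /av_v ->. Qed.

(** A line returning to [v] completes a path that avoids [v] between two of its half-lines, so
    [separated_path] leaves only [h] and [mv r h] for its end. *)
Lemma side_vertices_E h x : x.1 \in side_vertices h ->
  [\/ (E x).1 \in side_vertices h, x = E (v, h) | x = E (v, mv r h)].
Proof.
case/side_verticesP=> xv [k [kh c]]; have kv := near xv c.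
case: (eqVneq (E x).1 v) => [e | Exv].
  have ex : x = E (v, (E x).2) by rewrite -e -surjective_pairing EK.
  have := @sep k (E x).2 kv; rewrite -ex => /(_ xv c) kx.
  have [e2|e2] : (E x).2 = h \/ (E x).2 = mv r h.
    by case: kh kx => -> []; rewrite ?mvK; tauto.
  - by apply: Or32; rewrite {1}ex e2.
  - by apply: Or33; rewrite {1}ex e2.
apply: Or31; apply/side_verticesP; split=> //; exists k; split=> //.
apply: connect_trans c _; apply: connect1; rewrite /avoid /= !inE xv Exv /=.
by apply/existsP; exists x.2; rewrite -surjective_pairing.
Qed.

Lemma side_vertices_conn h w : w \in side_vertices h ->
  connect av (E (v, h)).1 w \/ connect av (E (v, mv r h)).1 w.
Proof. by case/side_verticesP=> _ [k [[] -> c]]; [left | right]. Qed.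

Lemma side_vertices_ends h :
  E (v, h) = (v, mv r h) /\ side_vertices h = set0 \/
  (E (v, h)).1 \in side_vertices h /\ (E (v, mv r h)).1 \in side_vertices h.
Proof.
have lp k : (E (v, k)).1 = v -> E (v, k) = (v, mv r k).
  move=> e; have e2 : E (v, k) = (v, (E (v, k)).2) by rewrite [LHS]surjective_pairing e.
  by rewrite e2 (loop e2).
case: (eqVneq (E (v, h)).1 v) => [/lp e | hv].
  left; split=> //; apply/setP => w; rewrite [RHS]inE; apply/negP.
  case/side_verticesP=> wv [k [[] -> ]]; first by rewrite e /= => /av_v /eqP; apply/negP.
  by rewrite -e EK /= => /av_v /eqP; apply/negP.
right; have hv' : (E (v, mv r h)).1 != v.
  apply: contraNneq hv => /lp; rewrite mvK => e.
  by rewrite -e EK.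
split; apply/side_verticesP; split=> //; first by exists h; split; [left | exact: connect0].
by exists (mv r h); split; [right | exact: connect0].
Qed.

Lemma side_vertices_v h : v \notin side_vertices h.
Proof. by rewrite inE eqxx. Qed.

(** A common vertex would connect half-lines of different pairs by a path avoiding [v]. *)
Lemma side_vertices_disjoint h k w : k != h -> k != mv r h ->
  w \in side_vertices h -> w \notin side_vertices k.
Proof.
move=> kh kr /side_verticesP[wv [h' [hh c]]]; apply/negP.
case/side_verticesP=> _ [k' [kk c']].
have := sep (near wv c) (near wv c').
rewrite (same_connect av_sym c) av_sym c' => /(_ isT).
have nk : k != h' /\ k != mv r h'.
  by case: hh => ->; rewrite ?mvK.
case: nk => n1 n2.
case: kk => -> [] e; first by rewrite e eqxx in n1.
- by rewrite e eqxx in n2.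
- by rewrite -e mvK eqxx in n2.
- by move/(inv_inj (mvK r)): e => e; rewrite e eqxx in n1.
Qed.

(** Together with [v] the two sides are closed under lines, and the graph is connected. *)
Lemma side_vertices_cover h k w : k != h -> k != mv r h ->
  [|| w == v, w \in side_vertices h | w \in side_vertices k].
Proof.
move=> kh kr.
have ends l : l \in [:: h; mv r h; k; mv r k].
  exact: mem_mv_pairs.
have e1 m : ((E (v, m)).1 == v) || ((E (v, m)).1 \in side_vertices m).
  by have [[-> _]|[-> _]] := side_vertices_ends m; rewrite ?eqxx ?orbT.
have e2 m : ((E (v, mv r m)).1 == v) || ((E (v, mv r m)).1 \in side_vertices m).
  have [[<- _]|[_ ->]] := side_vertices_ends m; last by rewrite orbT.
  by rewrite EK eqxx.
pose C := [pred w | [|| w == v, w \in side_vertices h | w \in side_vertices k]].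
have sub x : C x.1 -> C (E x).1.
  case/or3P=> [/eqP xv | /side_vertices_E[e | -> | ->] |
    /side_vertices_E[e | -> | ->]].
  - rewrite (surjective_pairing x) xv; move: (ends x.2); rewrite mem_seq4.
    by case/or4P=> /eqP ->; [move: (e1 h) | move: (e2 h) | move: (e1 k) |
      move: (e2 k)]; rewrite /C /= => /orP[] ->; rewrite ?orbT.
  - by rewrite /C /= e orbT.
  - by rewrite /C /= EK eqxx.
  - by rewrite /C /= EK eqxx.
  - by rewrite /C /= e !orbT.
  - by rewrite /C /= EK eqxx.
  - by rewrite /C /= EK eqxx.
suff step p w' : C w' -> path (avoid E set0) w' p -> C (last w' p).
  have /connectP[p e_p ->] := vacuum_avoid vacG v w.
  by apply: step e_p; rewrite /C /= eqxx.
elim: p w' => //= c p IHp w' Cw' /andP[/and3P[_ _ /existsP[l /eqP e]]].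
by apply: IHp; rewrite -e; apply: sub.
Qed.

(** For the middle slot, a side would hang at [h1] and [h3], both of sign +. The signs cancel along
    lines and at each vertex of the side, while [v] contributes 2. *)
Lemma separating_not_slot1 : r != slot1.
Proof.
apply/eqP => r1; pose K := side_vertices hl1.
pose sd := side v K hl1 (mv r hl1).
have sdE x : sd (E x) = sd x.
  exact: (side_E vacG (@side_vertices_E hl1) (side_vertices_ends hl1)).
pose sg (h : 'I_4) : int := if plusb h then 1%R else (-1)%R.
pose q (x : V * 'I_4) : int := if sd x then sg x.2 else 0%R.
have q0 : (\sum_x q x = 0)%R.
  have : (\sum_x q x = - \sum_x q x)%R.
    rewrite {1}(reindex_inj (inv_inj EK)) -sumrN; apply: eq_bigr => x _.
    rewrite /q /sg sdE Esgn; case: (sd x); last by rewrite oppr0.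
    by case: plusb; rewrite ?opprK.
  by lia.
have : (\sum_w \sum_(h < 4) q (w, h) = 0)%R.
  by rewrite -[RHS]q0 pair_bigA; apply: eq_bigr => -[].
have vK := side_vertices_v hl1.
rewrite (bigD1 v) //= [X in (_ + X)%R]big1 => [|w wv]; last first.
  rewrite /q /sd /side -/K.
  under eq_bigr do rewrite !xpair_eqE (negbTE wv) /= orbF.
  case: (w \in K); last by rewrite big1.
  by rewrite !big_ord_recl big_ord0.
have mv3 : mv r hl1 = hl3 by apply: val_inj; rewrite val_mv r1.
rewrite /q /sd /side -/K mv3.
by rewrite !big_ord_recl big_ord0 /= (negbTE vK) !xpair_eqE eqxx.
Qed.

End Separating.

(** * Decomposition at the vertex of the double tadpole *)

Section Core.

Variable G : sgraph.
Hypothesis vacG : vacuum G.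
Local Notation V := (vtx G).
Local Notation E := (@lineof G).

Variables s t : 'I_3.
Hypothesis u : uniq [:: slot0; s; t].
Hypothesis oddV : odd #|V|.
Hypothesis planar_s : slot_faces E slot0 + slot_faces E s = #|V| + 2.
Hypothesis planar_t : slot_faces E slot0 + slot_faces E t = #|V| + 2.
Hypothesis nlo : 2 * nfaces G = 3 * #|V| + 5.

Let EK := lineofK vacG.
Let Esgn := lineof_sign vacG.

Lemma mv_slot0_hl1 : hl2 = mv slot0 hl1.
Proof. by apply: val_inj; rewrite val_mv. Qed.

Lemma mv_slot0_hl3 : hl4 = mv slot0 hl3.
Proof. by apply: val_inj; rewrite val_mv. Qed.

(** With [slot0] as the separating slot, the half-line pairs at [v] are those of the double tadpole,
    so the identification relabels vertices only. *)
Lemma double_tadpole_insertion : exists o1 o2 (f : V -> ins_vtx o1 o2),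
  [/\ melonic2 o1, melonic2 o2, bijective f &
   forall w h, ins_lnk o1 o2 (f w, h) =
     omap (fun y => (f y.1, y.2)) (lnk G (w, h))].
Proof.
have s0 : slot0 != s by move: u; rewrite /= inE negb_or => /andP[/andP[]].
have [v same] := self_crossing EK Esgn (vacuum_avoid vacG) u oddV planar_t.
pose K1 := side_vertices v slot0 hl1; pose K2 := side_vertices v slot0 hl3.
have vK1 : v \notin K1 by apply: side_vertices_v.
have vK2 : v \notin K2 by apply: side_vertices_v.
have e12 := mv_slot0_hl1; have e34 := mv_slot0_hl3.
have K_E h := @side_vertices_E _ vacG v _ _ s0 planar_s same h.
have K1_E := K_E hl1; have K2_E := K_E hl3.
have K1_conn := @side_vertices_conn _ v slot0 hl1.
have K2_conn := @side_vertices_conn _ v slot0 hl3.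
have K_ab h := @side_vertices_ends _ vacG v _ _ s0 planar_s same h.
have K1_ab := K_ab hl1; have K2_ab := K_ab hl3.
have disj w : w \in K1 -> w \notin K2.
  by apply: (side_vertices_disjoint vacG s0 planar_s same); rewrite -?e12.
have cover w : [|| w == v, w \in K1 | w \in K2].
  by apply: (side_vertices_cover vacG s0 planar_s same); rewrite -?e12.
rewrite -/K1 -/K2 -e12 -e34 in K1_E K2_E K1_conn K2_conn K1_ab K2_ab.
have [o1 [g1 [[g1_inj g1_im [g1m g1p g1g]] [cnt1 le1 mel1]]]] :=
  piece_exists vacG (isT : plusb hl1) e12 vK1 K1_E K1_conn K1_ab.
have [o2 [g2 [[g2_inj g2_im [g2m g2p g2g]] [cnt2 le2 mel2]]]] :=
  piece_exists vacG (isT : plusb hl3) e34 vK2 K2_E K2_conn K2_ab.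
(* Face functions stay invariant after smoothing, by [side_same_face], and an invariant function of
   the smoothed graph is determined by its cuts on the two sides. For slots other than 0, smoothing
   creates at least one further face. *)
have count i :
    slot_faces E i + (i != slot0) <= piece_faces o1 i + piece_faces o2 i.
  pose S := invf (srel E (smooth v i)).
  have leS : #|S| <= 2 ^ (piece_faces o1 i + piece_faces o2 i).
    rewrite expnD; apply: leq_trans (leq_mul (cnt1 i) (cnt2 i)).
    rewrite -cardsX.
    pose cut K a b (phi : {ffun V * 'I_4 -> bool}) : {ffun V * 'I_4 -> bool} :=
      [ffun x => side v K a b x && phi x].
    pose f phi := (cut K1 hl1 hl2 phi, cut K2 hl3 hl4 phi).
    rewrite -(card_in_imset (f := f) (D := S)).
      apply/subset_leq_card/subsetP => _ /imsetP[phi /invf_srelP[phiE phis] ->].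
      rewrite in_setX; apply/andP; split; rewrite inE; apply/andP; split.
      - apply/invf_srelP; split=> x; rewrite !ffunE.
          by rewrite (side_E vacG K1_E K1_ab) phiE.
        by rewrite (side_smooth e12 vK1) phis.
      - by apply/forallP => x; apply/implyP => /negbTE nx; rewrite ffunE nx.
      - apply/invf_srelP; split=> x; rewrite !ffunE.
          by rewrite (side_E vacG K2_E K2_ab) phiE.
        by rewrite (side_smooth e34 vK2) phis.
      - by apply/forallP => x; apply/implyP => /negbTE nx; rewrite ffunE nx.
    move=> phi psi _ _ [/ffunP eq1 /ffunP eq2]; apply/ffunP => x.
    have := eq1 x; have := eq2 x; rewrite !ffunE.
    case: (boolP (side v K1 hl1 hl2 x)) => //= n1.
    suff -> : side v K2 hl3 hl4 x by [].
    move: n1; rewrite /side; case/or3P: (cover x.1) => [/eqP xv | -> | ->] //.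
    rewrite (surjective_pairing x) xv (negbTE vK1) !xpair_eqE eqxx /=.
    have := mem_mv_pairs (r := slot0) (h := hl1) (k := hl3) x.2 isT.
    by rewrite -e12 -e34 mem_seq4 => /(_ isT); case/or4P=> ->; rewrite ?orbT.
  rewrite -(leq_exp2l (m := 2)) // expnD -card_invf_slot //.
  apply: leq_trans leS; set I := invf (srel E (alpha i)).
  have IS : I \subset S.
    apply/subsetP => phi /invf_srelP[phiE phii]; apply/invf_srelP; split=> // -[w h].
    rewrite /smooth; case: eqP => [/= -> | _]; last exact: phii.
    have pe1 := side_same_face vacG e12 vK1 K1_E K1_ab phiE phii.
    have pe2 := side_same_face vacG e34 vK2 K2_E K2_ab phiE phii.
    have := mem_mv_pairs (r := slot0) (h := hl1) (k := hl3) h isT.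
    rewrite -e12 -e34 mem_seq4 => /(_ isT); rewrite /alpha /=.
    case/or4P=> /eqP ->; rewrite -?e12 -?e34 //.
      by rewrite e12 mvK -e12.
    by rewrite e34 mvK -e34.
  case: (eqVneq i slot0) => [_ | i0]; first by rewrite muln1 subset_leq_card.
  (* The indicator of the first side is invariant after smoothing but not under slot [i], which
     takes [h1] to the other side. Adding it doubles the space of invariant functions. *)
  pose one : {ffun V * 'I_4 -> bool} := [ffun x => side v K1 hl1 hl2 x].
  have sub : I :|: xorf one @: I \subset S.
    rewrite subUset IS /=; apply/subsetP => _ /imsetP[phi phiI ->].
    have /invf_srelP[phiE phis] := subsetP IS _ phiI.
    apply/invf_srelP; split=> x; rewrite !ffunE.
      by rewrite (side_E vacG K1_E K1_ab) phiE.
    by rewrite (side_smooth e12 vK1) phis.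
  apply: leq_trans (subset_leq_card sub).
  rewrite cardsU (_ : _ :&: _ = set0) ?cards0 ?subn0; last first.
    apply/setP => psi; rewrite [RHS]inE; apply/negP; rewrite in_setI.
    case/andP=> /invf_srelP[_ psii] /imsetP[phi /invf_srelP[_ phii] e].
    have := psii (v, hl1); rewrite e !ffunE phii.
    have -> : side v K1 hl1 hl2 (alpha i (v, hl1)) = false.
      rewrite /side /alpha /= (negbTE vK1) !xpair_eqE eqxx /=.
      rewrite (negbTE (mv_neq _ _)).
      by rewrite e12; apply/negbTE; apply: contra i0 => /eqP/mv_inj ->.
    by rewrite /side eqxx orbT; case: (phi _).
  by rewrite (card_imset _ (inv_inj (xorfK one))) muln2 addnn.
have card_V : #|V| = (#|K1| + #|K2|).+1.
  have -> : #|V| = #|v |: (K1 :|: K2)|.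
    rewrite -cardsT; congr #|pred_of_set _|; apply/setP => w.
    by rewrite !in_setU in_set1 inE cover.
  rewrite cardsU1 in_setU negb_or vK1 vK2 /= add1n cardsU.
  rewrite (_ : _ :&: _ = set0) ?cards0 ?subn0 //; apply/setP => w.
  by rewrite in_setI in_set0; apply/negP => /andP[/disj/negP].
have total : nfaces G + 2 <=
    \sum_(i < 3) piece_faces o1 i + \sum_(i < 3) piece_faces o2 i.
  rewrite nfaces_slots // !(sum_slots _ u).
  move: (count slot0) (count s) (count t); rewrite eqxx.
  move: u; rewrite /= !inE !negb_or andbT => /andP[/andP[n1 n2] _].
  by rewrite [s == _]eq_sym [t == _]eq_sym n1 n2; lia.
pose F (z : ins_vtx o1 o2) : V :=
  match z with None => v | Some (inl w) => g1 w | Some (inr w) => g2 w end.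
have g1K w : g1 w \in K1 by apply/g1_im; exists w.
have g2K w : g2 w \in K2 by apply/g2_im; exists w.
have g1v w : g1 w <> v by move=> e; move: vK1; rewrite -e g1K.
have g2v w : g2 w <> v by move=> e; move: vK2; rewrite -e g2K.
have g12 w w' : g1 w <> g2 w'.
  by move=> e; have := disj _ (g1K w); rewrite e g2K.
have F_inj : injective F.
  case=> [[w|w]|] [[w'|w']|] //= e.
  - by rewrite (g1_inj _ _ e).
  - by case: (g12 _ _ e).
  - by case: (g1v _ e).
  - by case: (g12 w' w).
  - by rewrite (g2_inj _ _ e).
  - by case: (g2v _ e).
  - by case: (g1v w').
  - by case: (g2v w').
have F_surj w : exists z, F z == w.
  case/or3P: (cover w) => [/eqP -> | /g1_im[z <-] | /g2_im[z <-]].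
  - by exists None; apply/eqP.
  - by exists (Some (inl z)); apply/eqP.
  - by exists (Some (inr z)); apply/eqP.
pose f w := xchoose (F_surj w).
have fK : cancel f F by move=> w; apply/eqP/(xchooseP (F_surj w)).
have Ff : cancel F f by move=> z; apply: F_inj; rewrite fK.
exists o1, o2, f; split.
(* By [nlo], [card_V] and [total], twice the faces of both pieces are at least
   [3 * #|K1| + 6 + (3 * #|K2| + 6)], so the bounds [le1] and [le2] are both equalities. *)
- by apply: mel1; lia.
- by apply: mel2; lia.
- by exists F.
have f1 z : f (g1 z) = Some (inl z) := Ff (Some (inl z)).
have f2 z : f (g2 z) = Some (inr z) := Ff (Some (inr z)).
have fv : f v = None := Ff None.
pose img (x : V * 'I_4) := Some (f x.1, x.2).
have L1 z : lift1 o1 o2 z = img (unfold_end v g1 z).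
  by case: z => [[w h]|h]; rewrite /img /= ?f1 ?fv.
have L2 z : lift2 o1 o2 z = img (unfold_end v g2 z).
  by case: z => [[w h]|h]; rewrite /img /= ?f2 ?fv.
move=> w h; rewrite lnk_lineof // -[RHS]/(img (E (w, h))) -{2}(fK w).
case: (f w) => [[z|z]|] /=; [by rewrite L1 g1g | by rewrite L2 g2g |].
have := mem_mv_pairs (r := slot0) (h := hl1) (k := hl3) h.
rewrite -e12 -e34 mem_seq4 => /(_ isT isT).
by case/or4P=> /eqP -> /=; rewrite ?L1 ?L2 ?g1m ?g1p ?g2m ?g2p.
Qed.

End Core.

(** * Exchange of the outer slots *)

(** Exchanges [h1] and [h3]: this reflects the cyclic order and thereby exchanges the slots 0 and
    2. *)
Definition swap_half (h : 'I_4) : 'I_4 := if plusb h then mv slot1 h else h.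

Definition swap_slot (s : 'I_3) : 'I_3 :=
  if s == slot0 then slot2 else if s == slot2 then slot0 else s.

Lemma swap_slotK : involutive swap_slot.
Proof. by case=> [[|[|[|s]]] Hs] //; apply: val_inj. Qed.

Lemma swap_halfK : involutive swap_half.
Proof.
move=> h; rewrite /swap_half; case hp: (plusb h); last by rewrite hp.
by rewrite plusb_mv hp mvK.
Qed.

Lemma plusb_swap h : plusb (swap_half h) = plusb h.
Proof. by rewrite /swap_half; case: ifP => // hp; rewrite plusb_mv hp. Qed.

Lemma swap_mv s h : swap_half (mv s h) = mv (swap_slot s) (swap_half h).
Proof.
rewrite /swap_half plusb_mv; apply: val_inj.
case: s => [[|[|[|s]]] Hs] //; case: h => [[|[|[|[|h]]]] Hh] //=;
  by rewrite !val_mv /= ?val_mv.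
Qed.

Lemma swap_vsym : vsym swap_half swap_slot.
Proof.
split; [by exists swap_half; exact: swap_halfK
       | by exists swap_slot; exact: swap_slotK | exact: plusb_swap |].
by move=> h s; rewrite !vstrandE /= swap_mv.
Qed.

Section Swap.

Variable G : sgraph.
Hypothesis vacG : vacuum G.

Let sw (x : vtx G * 'I_4) := (x.1, swap_half x.2).

Let swK : involutive sw.
Proof. by case=> v h; rewrite /sw /= swap_halfK. Qed.

Definition swap_graph : sgraph :=
  @SGraph (vtx G) (fun x => omap sw (lnk G (sw x))).

Local Notation H := swap_graph.

Lemma swap_lnk x : lnk H x = Some (sw (lineof (sw x))).
Proof. by rewrite /= lnk_lineof. Qed.

Lemma swap_lineof x : lineof (x : vtx H * 'I_4) = sw (lineof (sw x)).
Proof. by rewrite {1}/lineof swap_lnk. Qed.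

Lemma swap_vacuum : vacuum H.
Proof.
split; first by move=> x y; rewrite !swap_lnk => -[<-];
  rewrite swK lineofK // swK !plusb_swap lineof_sign // plusb_swap; case: plusb.
  by move=> x; rewrite swap_lnk.
split; first exact: vacuum_card vacG.
move=> v w; have [_ _ [_ /(_ v w)]] := vacG; apply: connect_sub.
move=> {}v {}w /existsP[h /existsP[k /eqP e]]; apply: connect1.
apply/existsP; exists (swap_half h); apply/existsP; exists (swap_half k).
by rewrite /= /sw /= swap_halfK e.
Qed.

Lemma swap_slot_faces s :
  slot_faces (@lineof H) s = slot_faces (@lineof G) (swap_slot s).
Proof.
rewrite /slot_faces.
have sym1 := srel_sym (lineofK vacG) (alphaK (swap_slot s)).
have sym2 := srel_sym (lineofK swap_vacuum) (alphaK s).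
have adj : rel_adjunction sw (srel (@lineof G) (alpha (swap_slot s)))
    (srel (@lineof H) (alpha s)) predT.
  apply: strict_adjunction => //; first exact: sym_connect_sym.
  - exact: inv_inj swK.
  - by apply/subsetP => x _; rewrite -[x]swK; apply: codom_f.
  - move=> x y _; rewrite /srel /= swap_lineof (inv_eq swK) /alpha /sw /=.
    by rewrite -swap_mv !xpair_eqE (inj_eq (inv_inj swap_halfK)).
rewrite [RHS](adjunction_n_comp _ _ _ _ adj) //; exact: sym_connect_sym.
Qed.

Lemma swap_nfaces : nfaces H = nfaces G.
Proof.
rewrite (nfaces_slots swap_vacuum) (nfaces_slots vacG).
rewrite [RHS](reindex_inj (inv_inj swap_slotK)); apply: eq_bigr => s _.
exact: swap_slot_faces.
Qed.

End Swap.

(** * Reduction to slot 0 and conclusion *)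

Local Open Scope ring_scope.

Theorem mainTheorem5 (G : sgraph) :
  vacuum G -> degree G = 1 / 2 ->
  exists o1 o2 : option tpg,
    [/\ melonic2 o1, melonic2 o2 & iso G (insert_2tp o1 o2)].
Proof.
move=> vacG; have -> : 1 / 2 = 3 - 5%:R / 2 :> rat by lra.
move/degreeP => nlo.
have euler := @vacuum_euler G vacG.
have [|oddV [r [s [t [u planar_s planar_t]]]]] := planar_jackets euler.
  by rewrite -nfaces_slots // nlo addnC.
have rs : r != s by move: u; rewrite /= !inE negb_or => /andP[/andP[]].
have [v same] := self_crossing (lineofK vacG) (lineof_sign vacG)
  (vacuum_avoid vacG) u oddV planar_t.
have r1 := separating_not_slot1 vacG rs planar_s same.
case: (eqVneq r slot0) => [r0 | r0].
  rewrite r0 in u planar_s planar_t.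
  have [o1 [o2 [f [m1 m2 bf lf]]]] :=
    double_tadpole_insertion vacG u oddV planar_s planar_t nlo.
  exists o1, o2; split=> //; exists f, (fun _ h => h), id; split=> // _.
  by split; [exists id | exists id | | move=> h i; rewrite -surjective_pairing].
have r2 : r = slot2.
  by apply: val_inj; move: r0 r1; rewrite -!val_eqE; case: (r) => [[|[|[|]]]].
(* In slot 2 the pairs are [h1], [h4] and [h2], [h3]. Relabelling brings them to slot 0, and [iso]
   absorbs the relabelling through [swap_vsym]. *)
pose H := swap_graph G; have vacH : vacuum H := swap_vacuum vacG.
have rE : swap_slot r = slot0 by rewrite r2.
have u' : uniq [:: slot0; swap_slot s; swap_slot t].
  by rewrite -rE (map_inj_uniq (inv_inj swap_slotK) [:: r; s; t]).
have faces i : slot_faces (@lineof H) (swap_slot i) = slot_faces (@lineof G) i.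
  by rewrite (swap_slot_faces vacG) swap_slotK.
have planar_s' : (slot_faces (@lineof H) slot0 +
    slot_faces (@lineof H) (swap_slot s) = #|vtx H| + 2)%N.
  by rewrite -rE !faces planar_s.
have planar_t' : (slot_faces (@lineof H) slot0 +
    slot_faces (@lineof H) (swap_slot t) = #|vtx H| + 2)%N.
  by rewrite -rE !faces planar_t.
have nlo' : (2 * nfaces H = 3 * #|vtx H| + 5)%N by rewrite swap_nfaces.
have [o1 [o2 [f [m1 m2 bf lf]]]] :=
  double_tadpole_insertion vacH u' oddV planar_s' planar_t' nlo'.
exists o1, o2; split=> //; exists f, (fun=> swap_half), swap_slot.
split=> // [_ | w h]; first exact: swap_vsym.
rewrite [LHS]lf /= swap_halfK; by case: (lnk G (w, h)).
Qed.
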